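(* Let $n \ge 2$ and $1<\alpha<2$, and let $2^* = \frac{2n}{n-\alpha}$. There exists a constant $a_{n,\alpha}>0$, depending only on $n$ and $\alpha$, such that for all $f \in C_c^{\infty}(\mathbb{R}^n_+)$, $$\int_{\mathbb{R}^n_+\times\mathbb{R}^n_+}\frac{|f(x)-f(y)|^2}{|x-y|^{n+\alpha}}\,dx\,dy - D_{n,2,\alpha}\int_{\mathbb{R}^n_+}\frac{|f(x)|^2}{x_n^{\alpha}}\,dx \;\ge\; a_{n,\alpha}\left(\int_{\mathbb{R}^n_+}|f(x)|^{2^*}\,dx\right)^{2/2^*}.$$
   Context: $\mathbb{R}^n_+ = \{x=(x',x_n)\in\mathbb{R}^n : x'\in\mathbb{R}^{n-1},\ x_n>0\}$ is the upper halfspace. $D_{n,2,\alpha}$ denotes the sharp constant in the fractional Hardy inequality on the halfspace for $p=2$, i.e. the largest constant $D$ such that $$\int_{\mathbb{R}^n_+\times\mathbb{R}^n_+}\frac{|f(x)-f(y)|^2}{|x-y|^{n+\alpha}}\,dx\,dy \ge D\int_{\mathbb{R}^n_+}\frac{|f(x)|^2}{x_n^{\alpha}}\,dx \quad\text{for all } f\in C_c(\mathbb{R}^n_+).$$ It is known that $D_{n,2,\alpha}>0$ in this range of $\alpha$. *)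

(* Defs.v *)
From HB Require Import structures.
From mathcomp Require Import all_boot all_order all_algebra.
From mathcomp Require Import all_classical all_reals all_analysis.

Set Implicit Arguments.
Unset Strict Implicit.
Unset Printing Implicit Defensive.

Import Order.TTheory GRing.Theory Num.Theory.
Import numFieldNormedType.Exports.

Local Open Scope classical_set_scope.
Local Open Scope ring_scope.

(* The sigma-algebra on 'rV[R]_n generated by the coordinate maps, i.e. the
   product of n copies of the Borel sigma-algebra of R, which is also the Borel
   sigma-algebra of R^n. *)
Definition rV_display : measure_display.
Proof. exact. Qed.

Section measurable_rV.
Variables (R : realType) (n : nat).

Let coord (i : 'I_n) (x : 'rV[R]_n) : measurableTypeR R := x 0 i.

Let rV_set0 : g_sigma_preimage coord set0.
Proof. exact: sigma_algebra0. Qed.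

Let rV_setC A : g_sigma_preimage coord A -> g_sigma_preimage coord (~` A).
Proof. exact: sigma_algebraC. Qed.

Let rV_bigcup (F : _^nat) : (forall i, g_sigma_preimage coord (F i)) ->
  g_sigma_preimage coord (\bigcup_i (F i)).
Proof. exact: sigma_algebra_bigcup. Qed.

HB.instance Definition _ := @isMeasurable.Build rV_display
  'rV[R]_n (g_sigma_preimage coord) rV_set0 rV_setC rV_bigcup.

Lemma measurable_coord (i : 'I_n) :
  measurable_fun [set: 'rV[R]_n] (fun x => x 0 i : measurableTypeR R).
Proof.
move=> _ Y mY; rewrite setTI; apply: sub_sigma_algebra => /=.
rewrite -bigcup_seq/=; exists i => /=; first by rewrite mem_index_enum.
by exists Y => //; rewrite setTI.
Qed.

Lemma measurable_fun_rV d (T : measurableType d) (f : T -> 'rV[R]_n) :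
  (forall i, measurable_fun [set: T] (fun t => f t 0 i : measurableTypeR R)) ->
  measurable_fun [set: T] f.
Proof.
move=> mf.
apply: (measurability
  (\big[setU/set0]_(i < n) preimage_set_system setT (coord i) measurable)) => //.
move=> _ [A + <-]; rewrite -bigcup_seq/= => -[i _ [B mB <-]].
by rewrite [X in _ `&` _ @^-1` X]setTI; exact: mf.
Qed.

End measurable_rV.

Lemma sigma_finite_product d1 d2 (T1 : measurableType d1)
    (T2 : measurableType d2) (R : realType)
    (m1 : {sigma_finite_measure set T1 -> \bar R})
    (m2 : {sigma_finite_measure set T2 -> \bar R}) :
  sigma_finite setT (m1 \x m2)%E.
Proof.
have /sigma_finiteP[F [TF ndF Foo]] := sigma_finiteT m1.
have /sigma_finiteP[G [TG ndG Goo]] := sigma_finiteT m2.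
exists (fun n => F n `*` G n).
  rewrite -setXTT TF TG predeqE => -[x y]; split.
    move=> [/= [n _ Fnx] [k _ Gky]]; exists (maxn n k) => //; split.
    - by move: x Fnx; exact/subsetPset/ndF/leq_maxl.
    - by move: y Gky; exact/subsetPset/ndG/leq_maxr.
  by move=> [n _ []/= ? ?]; split; exists n.
move=> k; have [? ?] := Foo k; have [? ?] := Goo k.
split; first exact: measurableX.
by rewrite product_measure1E// lte_mul_pinfty// ge0_fin_numE.
Qed.

Section lebesgue_rV.
Variable R : realType.

Definition cons_rV n (p : measurableTypeR R * 'rV[R]_n) : 'rV[R]_n.+1 :=
  row_mx (\row_(_ < 1) p.1) p.2.

Definition behead_rV n (x : 'rV[R]_n.+1) : measurableTypeR R * 'rV[R]_n :=
  (x 0 ord0, \row_i x 0 (lift ord0 i)).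

Lemma cons_rV0 n p : @cons_rV n p 0 ord0 = p.1.
Proof.
rewrite /cons_rV (_ : ord0 = lshift n (ord0 : 'I_1)); last exact/val_inj.
by rewrite (row_mxEl (\row_(_ < 1) p.1)) mxE.
Qed.

Lemma cons_rVS n p i : @cons_rV n p 0 (lift ord0 i) = p.2 0 i.
Proof.
rewrite /cons_rV (_ : lift ord0 i = rshift 1 i); last exact/val_inj.
by rewrite (row_mxEr (\row_(_ < 1) p.1)).
Qed.

Lemma cons_rVK n : cancel (@cons_rV n) (@behead_rV n).
Proof.
case=> a x; rewrite /behead_rV cons_rV0; congr pair.
by apply/rowP => i; rewrite mxE cons_rVS.
Qed.

Lemma behead_rVK n : cancel (@behead_rV n) (@cons_rV n).
Proof.
move=> x; apply/rowP => i; case: (unliftP ord0 i) => [j ->|->].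
  by rewrite cons_rVS mxE.
by rewrite cons_rV0.
Qed.

Lemma measurable_cons_rV n : measurable_fun setT (@cons_rV n).
Proof.
apply: measurable_fun_rV => i; case: (unliftP ord0 i) => [j ->|->].
  under eq_fun do rewrite cons_rVS.
  exact: (measurableT_comp (measurable_coord j)).
under eq_fun do rewrite cons_rV0; exact: measurable_fst.
Qed.

Lemma measurable_behead_rV n : measurable_fun setT (@behead_rV n).
Proof.
apply: measurable_fun_pair; first exact: measurable_coord.
apply: measurable_fun_rV => i; under eq_fun do rewrite mxE.
exact: measurable_coord.
Qed.

Section step.
Variables (n : nat) (mu : {sigma_finite_measure set 'rV[R]_n -> \bar R}).

Definition lebesgue_step : set 'rV[R]_n.+1 -> \bar R :=
  pushforward (lebesgue_measure \x mu)%E (@cons_rV n).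

Let step0 : lebesgue_step set0 = 0%E.
Proof. by rewrite /lebesgue_step /pushforward preimage_set0 measure0. Qed.

Let step_ge0 A : (0 <= lebesgue_step A)%E.
Proof. exact: (measure_ge0 (lebesgue_measure \x mu)%E). Qed.

Let measurable_preimage A : measurable A -> measurable (@cons_rV n @^-1` A).
Proof.
by move=> mA; rewrite -[X in measurable X]setTI; exact: measurable_cons_rV.
Qed.

Let step_sigma_additive : semi_sigma_additive lebesgue_step.
Proof.
move=> F mF tF mUF; rewrite /lebesgue_step /pushforward preimage_bigcup.
apply: measure_semi_sigma_additive.
- by move=> k; exact: measurable_preimage.
- apply/trivIsetP => /= i j _ _ ij; rewrite -preimage_setI.
  by move/trivIsetP : tF => /(_ _ _ _ _ ij) ->//; rewrite preimage_set0.
- by rewrite -preimage_bigcup; exact: measurable_preimage.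
Qed.

HB.instance Definition _ := isMeasure.Build _ _ _ lebesgue_step
  step0 step_ge0 step_sigma_additive.

Lemma sigma_finite_lebesgue_step : sigma_finite setT lebesgue_step.
Proof.
have [F TF mF] := sigma_finite_product lebesgue_measure mu.
exists (fun k => @behead_rV n @^-1` F k).
  by rewrite -preimage_bigcup -TF preimage_setT.
move=> k; have [mFk Fkoo] := mF k; split.
  by rewrite -[X in measurable X]setTI; exact: measurable_behead_rV.
rewrite /lebesgue_step /pushforward -comp_preimage.
by rewrite (_ : _ \o _ = id) ?preimage_id//; apply/funext => p /=; rewrite cons_rVK.
Qed.

HB.instance Definition _ :=
  Measure_isSigmaFinite.Build _ _ _ lebesgue_step sigma_finite_lebesgue_step.

End step.

(* Lebesgue measure on R^n: the n-fold product of the Lebesgue measure of R,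
   transported to row vectors. *)
Fixpoint lebesgue_rV n : {sigma_finite_measure set 'rV[R]_n -> \bar R} :=
  match n return {sigma_finite_measure set 'rV[R]_n -> \bar R} with
  | 0 => \d_(0 : 'rV[R]_0)
  | m.+1 => lebesgue_step (lebesgue_rV m)
  end.

Lemma lebesgue_rV_box n (A : 'I_n -> set (measurableTypeR R)) :
  (forall i, measurable (A i)) ->
  lebesgue_rV n [set x | forall i, A i (x 0 i)] =
    (\prod_(i < n) lebesgue_measure (A i))%E.
Proof.
elim: n A => [|n IH] A mA.
  rewrite big_ord0 /= diracE mem_set//; by case.
rewrite big_ord_recl -IH; last by move=> i; exact: mA.
have mbox : measurable [set x : 'rV[R]_n | forall i, A (lift ord0 i) (x 0 i)].
  rewrite [X in measurable X](_ : _ = \bigcap_(i in [set: 'I_n])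
      ((fun x : 'rV[R]_n => x 0 i : measurableTypeR R) @^-1` A (lift ord0 i))).
    apply: fin_bigcap_measurable => // i _.
    by rewrite -[X in measurable X]setTI; exact: measurable_coord.
  by apply/seteqP; split => x /= h i => [_|]; exact: h.
rewrite -product_measure1E//.
rewrite /= /lebesgue_step /pushforward; congr (_ \x _)%E.
apply/seteqP; split => p /= => [h|[h0 hS] i].
  split; first by rewrite -(cons_rV0 p).
  by move=> i; rewrite -(cons_rVS p).
by case: (unliftP ord0 i) => [j ->|->]; rewrite ?cons_rVS ?cons_rV0.
Qed.

End lebesgue_rV.

Section halfspace.
Variable R : realType.

Definition enorm n (x : 'rV[R]_n) : R := Num.sqrt (\sum_(i < n) x 0 i ^+ 2).

(* The coordinate x_n; the value in dimension 0 is a dummy. *)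
Definition xlast n : 'rV[R]_n -> R :=
  match n with
  | 0 => fun=> 0
  | m.+1 => fun x => x 0 ord_max
  end.

Definition halfspace n : set 'rV[R]_n := [set x | 0 < xlast x].

Definition supp n (f : 'rV[R]_n -> R) : set 'rV[R]_n :=
  closure [set x | f x != 0].

(* Functions on the open halfspace with compact support in it are identified
   with their extensions by zero to R^n. *)
Definition Cc_halfspace n (f : 'rV[R]_n -> R) : Prop :=
  [/\ continuous f, compact (supp f) & supp f `<=` @halfspace n].

(* All partial derivatives of order at most k exist and are continuous. *)
Fixpoint C_k n (k : nat) (f : 'rV[R]_n -> R) : Prop :=
  continuous f /\
  match k with
  | 0 => True
  | l.+1 => forall i : 'I_n,
      (forall x, derivable f x (delta_mx 0 i)) /\
      C_k l (fun x => 'D_(delta_mx 0 i) f x)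
  end.

Definition Cc_infty_halfspace n (f : 'rV[R]_n -> R) : Prop :=
  Cc_halfspace f /\ forall k, C_k k f.

Local Open Scope ereal_scope.

Definition fractional_energy n (alpha : R) (f : 'rV[R]_n -> R) : \bar R :=
  \int[lebesgue_rV R n \x lebesgue_rV R n]_(z in @halfspace n `*` @halfspace n)
    (`|f z.1 - f z.2| ^+ 2 / enorm (z.1 - z.2) `^ (n%:R + alpha))%:E.

Definition hardy_integral n (alpha : R) (f : 'rV[R]_n -> R) : \bar R :=
  \int[lebesgue_rV R n]_(x in @halfspace n)
    (`|f x| ^+ 2 / xlast x `^ alpha)%:E.

(* The set contains 0 and is closed under suprema, and it is bounded above as
   soon as some f has finite energy and a positive Hardy integral; the supremum
   is then its largest element, the sharp constant D_{n,2,alpha}. *)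
Definition hardy_constant (n : nat) (alpha : R) : R :=
  sup [set D : R | forall f : 'rV[R]_n -> R, Cc_halfspace f ->
    D%:E * hardy_integral alpha f <= fractional_energy alpha f].

End halfspace.

(* Main.v *)
Require Import Defs.
From HB Require Import structures.
From mathcomp Require Import all_boot all_order all_algebra.
From mathcomp Require Import all_classical all_reals all_analysis.
From mathcomp Require Import measurable_realfun ring lra.

Import Order.TTheory GRing.Theory Num.Theory.
Import numFieldNormedType.Exports.

Local Open Scope classical_set_scope.
Local Open Scope ring_scope.

(* Let w(x) = x_n^((alpha-1)/2) and k(x,y) = |x-y|^-(n+alpha). Writing f = w v, the
   energy E of f minus a multiple of its Hardy integral H is the ground energy
   J = \int\int w(x) w(y) |v(x)-v(y)|^2 k(x,y) dx dy. To avoid principal values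
   the kernel is multiplied by min(1, m|x-y|^2/(x_n y_n)), which is invariant under
   the affine maps of the halfspace: then E_m = J_m + V_m H exactly, with an absolutely
   convergent constant V_m, by Tonelli's theorem and the substitution
   y = x_n z + (x',0).
   The value of the sharp constant is never needed. Logarithmic cutoffs of w have
   J <= delta H, so every D admissible in the Hardy inequality satisfies
   V_m >= D - delta for large m, and letting m tend to infinity gives
   E - D H >= J for the sharp constant D.
   Finally J dominates the squared L^p norm of f: if r is chosen so that
   r^n = 2 (2/|f(x)|)^p \int |f|^p, then by Chebyshev |f| <= |f(x)|/2 on half of the
   cube [x, x + r]^n, where moreover w >= w(x). Hence
   \int w(x) w(y) |v(x)-v(y)|^2 k(x,y) dy >= c |f(x)|^2 r^-alpha, and the right-hand
   side integrates to a multiple of (\int |f|^p)^(2/p). *)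

(** The exponent (alpha-1)/2 makes w^2 x_n^-alpha equal to x_n^-1, so over a box the Hardy integral
    of w grows only with the logarithm of the ratio of heights. A cutoff spread over a long
    logarithmic range therefore costs little energy compared with it. The truncation vanishes
    quadratically on the diagonal, and |x-y|^2 k(x,y) is locally integrable because alpha < 2. It
    has to be invariant under the affine maps: a cutoff in |x-y| alone would produce a potential
    that is not a constant multiple of x_n^-alpha. In the last step the cube has x as its lower
    corner, so it stays in the halfspace for every r and no case distinction near the boundary
    arises; w >= w(x) on it because alpha > 1. Energies may be infinite as far as the proof knows.
    Identities are therefore arranged as sums of nonnegative integrals, and only quantities known to
    be finite are moved across. *)

Set Implicit Arguments.
Unset Strict Implicit.
Unset Printing Implicit Defensive.

(** * Lebesgue measure on R^n *)

Section affine_change.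
Variable R : realType.
Implicit Types (t b : R).

Lemma measurable_affine t b :
  measurable_fun [set: measurableTypeR R]
    (fun z : measurableTypeR R => t * z + b : measurableTypeR R).
Proof.
by apply: measurable_funD => //; apply: measurable_funM.
Qed.

(** The pushforward of Lebesgue measure under the affine map, multiplied by t, agrees with Lebesgue
    measure on half-open intervals, hence everywhere. *)
Lemma integral_affine t b (t_gt0 : 0 < t) (g : measurableTypeR R -> \bar R) :
  measurable_fun setT g -> (forall x, 0 <= g x)%E ->
  (\int[lebesgue_measure]_x g x = t%:E * \int[lebesgue_measure]_x g (t * x + b)%R)%E.
Proof.
move=> mg g0.
have ma := measurable_affine t b.
have push := @ge0_integral_pushforward _ _ _ _ R _ ma (@lebesgue_measure R) setT g
  measurableT mg (fun y _ => g0 y).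
rewrite /= preimage_setT in push; rewrite -{}push.
rewrite -[X in (X%:E * _)%E]/((NngNum (ltW t_gt0))%:num).
rewrite -ge0_integral_mscale//.
apply: eq_measure_integral => A mA _.
apply: lebesgue_measure_unique => //.
move=> _ [[a c] _ <-].
transitivity (t%:E * lebesgue_measure
  ((fun z : measurableTypeR R => (t * z + b)%R) @^-1` `]a, c]%classic))%E; last by [].
rewrite [X in _ = (_ * _ X)%E](_ : _ = `](a - b) / t, (c - b) / t]%classic); last first.
    apply/seteqP; split => z /=; rewrite !in_itv/=.
      by rewrite ltr_pdivrMr// ler_pdivlMr// => /andP[? ?]; apply/andP; split; lra.
    by rewrite ltr_pdivrMr// ler_pdivlMr// => /andP[? ?]; apply/andP; split; lra.
  rewrite !lebesgue_measure_itv/= !lte_fin.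
  rewrite ltr_pM2r ?invr_gt0// ltrD2r.
  case: ifP => _; last by rewrite mule0.
  by rewrite -!EFinD -EFinM; congr EFin; field; rewrite gt_eqF.
Qed.

End affine_change.

Section rV.
Variable R : realType.

Lemma integral_rV_cons n (g : 'rV[R]_n.+1 -> \bar R) :
  measurable_fun setT g -> (forall x, 0 <= g x)%E ->
  (\int[lebesgue_rV R n.+1]_x g x =
   \int[lebesgue_measure]_a \int[lebesgue_rV R n]_x g (cons_rV (a, x)))%E.
Proof.
move=> mg g0.
transitivity (\int[pushforward (lebesgue_measure \x lebesgue_rV R n)%E
  (@cons_rV R n)]_x g x)%E; first by [].
rewrite ge0_integral_pushforward//; last exact: measurable_cons_rV.
rewrite preimage_setT fubini_tonelli1//.
- by apply: measurableT_comp => //; exact: measurable_cons_rV.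
- by move=> x /=.
Qed.

Lemma measurable_cons_rVr n (a : R) :
  measurable_fun setT (fun x : 'rV[R]_n => cons_rV (a, x)).
Proof.
apply: (measurableT_comp (@measurable_cons_rV R n)).
exact: measurable_fun_pair.
Qed.

Lemma measurable_rV_affine n (t : R) (b : 'rV[R]_n) :
  measurable_fun setT (fun x : 'rV[R]_n => t *: x + b).
Proof.
apply: measurable_fun_rV => i.
under eq_fun do rewrite !mxE.
apply: measurable_funD => //; apply: measurable_funM => //.
exact: measurable_coord.
Qed.

(** Induction on the dimension: Tonelli splits off the first coordinate, which contributes one
    factor t by the one-dimensional case. *)
Lemma integral_rV_affine n (t : R) (b : 'rV[R]_n) (t_gt0 : 0 < t)
    (g : 'rV[R]_n -> \bar R) :
  measurable_fun setT g -> (forall x, 0 <= g x)%E ->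
  (\int[lebesgue_rV R n]_x g x =
   (t ^+ n)%:E * \int[lebesgue_rV R n]_x g (t *: x + b)%R)%E.
Proof.
elim: n b g => [|n IH] b g mg g0.
  rewrite expr0 mul1e; apply: eq_integral => x _; congr g.
  by apply/rowP; case.
have mgc a : measurable_fun setT (fun x => g (cons_rV (a, x))).
  by apply: measurableT_comp => //; exact: measurable_cons_rVr.
rewrite !integral_rV_cons//; last first.
  by apply: measurableT_comp => //; exact: measurable_rV_affine.
pose b' : 'rV[R]_n := (behead_rV b).2.
pose h (a : R) := (\int[lebesgue_rV R n]_x g (cons_rV (a, x)))%E.
have mh : measurable_fun setT h.
  apply: (@measurable_fun_fubini_tonelli_F _ _ _ _ _ (lebesgue_rV R n) (g \o @cons_rV R n)).
  - by apply: measurableT_comp => //; exact: measurable_cons_rV.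
  - by move=> x /=.
have h0 x : (0 <= h x)%E by exact: integral_ge0.
rewrite -/h (integral_affine (b 0 ord0) t_gt0 mh h0).
rewrite exprS EFinM -muleA; congr (_ * _)%E.
have t0 : (0 <= (t ^+ n)%:E)%E by rewrite lee_fin exprn_ge0// ltW.
rewrite -ge0_integralZl//.
- apply: eq_integral => a _; rewrite /h (IH b')//.
  congr (_ * _)%E; apply: eq_integral => x _; congr g.
  apply/rowP => i; case: (unliftP ord0 i) => [j ->|->].
    by rewrite [RHS]mxE [X in _ = X + _]mxE !cons_rVS/= !mxE.
  by rewrite [RHS]mxE [X in _ = X + _]mxE !cons_rV0.
- apply: (@measurable_fun_fubini_tonelli_F _ _ _ _ _ (lebesgue_rV R n)
    (fun z => g (t *: cons_rV z + b))).
    apply: measurableT_comp => //.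
    apply: (measurableT_comp (measurable_rV_affine t b)).
    exact: measurable_cons_rV.
  by [].
- by move=> x _; exact: integral_ge0.
Qed.

End rV.

Section rV2.
Variable R : realType.

Lemma measurable_rV_box n (A : 'I_n -> set (measurableTypeR R)) :
  (forall i, measurable (A i)) ->
  measurable [set x : 'rV[R]_n | forall i, A i (x 0 i)].
Proof.
move=> mA; rewrite [X in measurable X](_ : _ = \bigcap_(i in [set: 'I_n])
    ((fun x : 'rV[R]_n => x 0 i : measurableTypeR R) @^-1` A i)).
  apply: fin_bigcap_measurable => // i _.
  by rewrite -[X in measurable X]setTI; exact: measurable_coord.
by apply/seteqP; split => x /= h i => [_|]; exact: h.
Qed.

(** The sigma-algebra is generated by the coordinates, so countability must enter: U is the union of
    the boxes with rational centre and radius 1/(j+1) that it contains, enumerated through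
    [unpickle]. *)
Lemma open_measurable_rV n (U : set 'rV[R]_n) : open U -> measurable U.
Proof.
move=> oU.
pose box (q : 'rV[rat]_n) (j : nat) : set 'rV[R]_n :=
  [set x | forall i, ball (ratr (q 0 i) : R) j.+1%:R^-1 (x 0 i)].
pose F k : set 'rV[R]_n := match @unpickle ('rV[rat]_n * nat)%type k with
  | Some (q, j) => if `[< box q j `<=` U >] then box q j else set0
  | None => set0 end.
rewrite (_ : U = \bigcup_k F k).
  apply: bigcup_measurable => k _; rewrite /F.
  case: unpickle => // -[q j]; case: ifP => // _.
  apply: (@measurable_rV_box _ (fun i => ball (ratr (q 0 i) : R) j.+1%:R^-1)) => i.
  exact: measurable_ball.
apply/seteqP; split => [x Ux|x [k _]]; last first.
  by rewrite /F; case: unpickle => // -[q j]; case: asboolP => // bU /bU.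
move: oU; rewrite openE => /(_ _ Ux)/nbhs_ballP[e /= e0 eU].
(* Twice the radius, because x is joined to a point of the box through its rational centre. *)
have [j je] : exists j, 2 * j.+1%:R^-1 <= e :> R.
  exists (Num.truncn (2 / e)).
  rewrite ler_pdivrMr ?ltr0n// mulrC -ler_pdivrMr//.
  exact/ltW/truncnS_gt.
have j0 : 0 < j.+1%:R^-1 :> R by rewrite invr_gt0.
have [q qx] : exists q : 'I_n -> rat, forall i, `|x 0 i - ratr (q i)| < j.+1%:R^-1.
  suff /choice[q hq] : forall i, exists q : rat, `|x 0 i - ratr q| < j.+1%:R^-1 by exists q.
  move=> i; set d := j.+1%:R^-1 in j0 *.
  have /rat_in_itvoo[q] : x 0 i < x 0 i + d by rewrite ltrDl.
  rewrite in_itv/= => /andP[? ?]; exists q.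
  by rewrite ltr_norml; apply/andP; split; lra.
exists (pickle (\row_i q i, j)) => //; rewrite /F pickleK asboolT.
  by move=> i /=; rewrite mxE; rewrite /ball/= distrC.
move=> y /= hy; apply: eU; split => // a i; rewrite (ord1 a).
have := hy i; rewrite mxE /ball/= => hyi.
rewrite -(subrKA (ratr (q i))).
apply: le_lt_trans (ler_normD _ _) _; have := qx i; move: hyi je.
by set d := j.+1%:R^-1; lra.
Qed.

Lemma continuous_measurable_rV n (f : 'rV[R]_n -> R) :
  continuous f -> measurable_fun setT f.
Proof.
move=> /continuousP cf; apply: (measurability _ (RGenOpens.measurableE R)).
move=> _ [_ [a [b ->] <-]]; rewrite setTI; apply: open_measurable_rV.
exact/cf/interval_open.
Qed.

Lemma integral_rV_prod n (g : 'I_n -> measurableTypeR R -> R) :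
  (forall i, measurable_fun setT (g i)) -> (forall i x, 0 <= g i x) ->
  (\int[lebesgue_rV R n]_x (\prod_(i < n) g i (x 0 i))%:E =
   \prod_(i < n) \int[lebesgue_measure]_a (g i a)%:E)%E.
Proof.
elim: n g => [|n IH] g mg g0.
  under eq_integral do rewrite big_ord0.
  by rewrite big_ord0 integral_cst//= diracT mule1.
have mprod : measurable_fun setT (fun x : 'rV[R]_n.+1 => (\prod_(i < n.+1) g i (x 0 i))).
  apply: measurable_prod => i _.
  exact: (measurableT_comp (mg _) (measurable_coord i)).
have mprod' : measurable_fun setT
    (fun x : 'rV[R]_n => (\prod_(i < n) g (lift ord0 i) (x 0 i))).
  apply: measurable_prod => i _.
  exact: (measurableT_comp (mg _) (measurable_coord i)).
rewrite integral_rV_cons; first last.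
- by move=> x; rewrite lee_fin; apply: prodr_ge0.
- exact/measurable_EFinP.
under eq_integral => a _.
  under eq_integral => x _.
    rewrite big_ord_recl cons_rV0/=.
    under eq_bigr do rewrite cons_rVS/=.
    rewrite EFinM.
    over.
  rewrite ge0_integralZl//=.
  + over.
  + exact/measurable_EFinP.
  + by move=> x _; rewrite lee_fin; apply: prodr_ge0.
  + by rewrite lee_fin.
rewrite big_ord_recl -IH// ge0_integralZr//.
- exact/measurable_EFinP.
- by move=> x _; rewrite lee_fin.
- by apply: integral_ge0 => x _; rewrite lee_fin; apply: prodr_ge0.
Qed.

End rV2.

(** * The halfspace and its affine maps *)

Section enorm_theory.
Variables (R : realType) (n : nat).
Implicit Types x y : 'rV[R]_n.

Lemma enorm_ge0 x : 0 <= enorm x.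
Proof. exact: sqrtr_ge0. Qed.

Lemma enormN x : enorm (- x) = enorm x.
Proof. by rewrite /enorm; under eq_bigr do rewrite mxE sqrrN. Qed.

Lemma enorm_distC x y : enorm (x - y) = enorm (y - x).
Proof. by rewrite -enormN opprB. Qed.

Lemma enormZ (t : R) x : 0 <= t -> enorm (t *: x) = t * enorm x.
Proof.
move=> t0; rewrite /enorm; under eq_bigr do rewrite mxE exprMn.
by rewrite -mulr_sumr sqrtrM ?exprn_ge0// sqrtr_sqr ger0_norm.
Qed.

Lemma ler_coord_enorm x i : `|x 0 i| <= enorm x.
Proof.
rewrite -sqrtr_sqr; apply: ler_wsqrtr.
by rewrite (bigD1 i)//= lerDl sumr_ge0// => j _; exact: sqr_ge0.
Qed.

(** The factor n in place of its square root is crude; it only affects the final constant. *)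
Lemma enorm_le x (r : R) : 0 <= r -> (forall i, `|x 0 i| <= r) ->
  enorm x <= n%:R * r.
Proof.
move=> r0 xr; rewrite -[leRHS]ger0_norm ?mulr_ge0// -sqrtr_sqr; apply: ler_wsqrtr.
apply: (@le_trans _ _ (n%:R * r ^+ 2)).
  apply: (@le_trans _ _ (\sum_(i < n) r ^+ 2)).
    by apply: ler_sum => i _; rewrite -real_normK ?num_real// lerXn2r ?nnegrE.
  by rewrite sumr_const card_ord mulr_natl.
rewrite exprMn ler_wpM2r ?sqr_ge0//.
by rewrite -natrX ler_nat; case: (n) => // k; rewrite leq_pmulr.
Qed.

Lemma enorm_eq0 x : enorm x = 0 -> x = 0.
Proof.
move=> x0; apply/rowP => i; rewrite mxE; apply/eqP.
by rewrite -normr_le0 -x0 ler_coord_enorm.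
Qed.

Lemma measurable_enorm : measurable_fun [set: 'rV[R]_n] (@enorm R n).
Proof.
apply: (measurableT_comp (continuous_measurable_fun (@sqrt_continuous R))).
apply: measurable_sum => i; apply: measurable_funX; exact: measurable_coord.
Qed.

Lemma measurable_rVB d (T : measurableType d) (f g : T -> 'rV[R]_n) :
  measurable_fun setT f -> measurable_fun setT g ->
  measurable_fun setT (fun t => f t - g t).
Proof.
move=> mf mg; apply: measurable_fun_rV => i; under eq_fun do rewrite !mxE.
by apply: measurable_funB; exact: (measurableT_comp (measurable_coord i)).
Qed.

Lemma measurable_rVZ d (T : measurableType d) (h : T -> measurableTypeR R)
    (f : T -> 'rV[R]_n) :
  measurable_fun setT h -> measurable_fun setT f ->
  measurable_fun setT (fun t => h t *: f t).
Proof.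
move=> mh mf; apply: measurable_fun_rV => i; under eq_fun do rewrite mxE.
by apply: measurable_funM => //; exact: (measurableT_comp (measurable_coord i)).
Qed.

End enorm_theory.

Lemma measurable_inv_ge0 d (T : measurableType d) (R : realType) (f : T -> R) :
  measurable_fun setT f -> (forall x, 0 <= f x) -> measurable_fun setT (fun x => (f x)^-1).
Proof.
move=> mf f0; under eq_fun do rewrite -powR_inv1//.
exact: (measurableT_comp (measurable_powR _)).
Qed.

(** * Tonelli and the affine substitution on the halfspace *)

Section halfspace_integrals.
Variables (R : realType) (n : nat).
Local Notation V := 'rV[R]_n.+1.
Local Notation mu := (lebesgue_rV R n.+1).
Local Notation H := (@halfspace R n.+1).
Implicit Types x y : V.

Lemma measurable_xlast : measurable_fun [set: V] (@xlast R n.+1).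
Proof. exact: measurable_coord. Qed.

Lemma measurable_halfspace : measurable H.
Proof.
rewrite [X in measurable X](_ : _ = @xlast R n.+1 @^-1` `]0, +oo[); last first.
  by apply/seteqP; split => x /=; rewrite in_itv/= andbT.
by rewrite -[X in measurable X]setTI; exact: measurable_xlast.
Qed.
Local Hint Resolve measurable_halfspace : core.

Lemma measurable_halfspaceX_restrict (F : V * V -> R) : measurable_fun setT F ->
  measurable_fun setT ((fun p => (F p)%:E) \_ (H `*` H)).
Proof.
move=> mF; have mHH := measurableX measurable_halfspace measurable_halfspace.
apply/(measurable_restrictT (fun p => (F p)%:E) mHH).
by apply: measurable_funTS; exact/measurable_EFinP.
Qed.

Lemma halfspaceX_restrict_ge0 (F : V * V -> R) : (forall p, 0 <= F p) ->
  forall p, (0 <= ((fun p => (F p)%:E) \_ (H `*` H)) p)%E.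
Proof. by move=> F0 p; rewrite patchE; case: ifP => // _; rewrite lee_fin. Qed.

Lemma measurable_integral_halfspace (F : V * V -> R) :
  measurable_fun setT F -> (forall p, 0 <= F p) ->
  measurable_fun setT (fun x => \int[mu]_(y in H) (F (x, y))%:E)%E.
Proof.
move=> mF F0.
pose F' : V * V -> \bar R := (fun p => (F p)%:E) \_ (setT `*` H).
have mF' : measurable_fun setT F'.
  apply/(measurable_restrictT (fun z => (F z)%:E)
    (measurableX measurableT measurable_halfspace)).
  by apply: measurable_funTS; exact/measurable_EFinP.
have F'0 p : (0 <= F' p)%E by rewrite /F' patchE; case: ifP => // _; rewrite lee_fin.
suff -> : (fun x => \int[mu]_(y in H) (F (x, y))%:E)%E = fubini_F mu F'.
  exact: measurable_fun_fubini_tonelli_F.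
apply/funext => x; rewrite /fubini_F [LHS]integral_mkcond; apply: eq_integral => y _.
rewrite /F' !patchE; congr (if _ then _ else _).
by apply/idP/idP => /set_mem h; apply/mem_set => //; case: h.
Qed.

Lemma integral_halfspaceX (F : V * V -> R) :
  measurable_fun setT F -> (forall z, 0 <= F z) ->
  (\int[mu \x mu]_(z in H `*` H) (F z)%:E =
   \int[mu]_(x in H) \int[mu]_(y in H) (F (x, y))%:E)%E.
Proof.
move=> mF F0; rewrite integral_mkcond.
rewrite (fubini_tonelli1 _ (measurable_halfspaceX_restrict mF) (halfspaceX_restrict_ge0 F0)).
rewrite [RHS]integral_mkcond; apply: eq_integral => x _.
rewrite /fubini_F [RHS]patchE; case: ifPn => [/set_mem xH|/negP xH].
  rewrite [RHS]integral_mkcond; apply: eq_integral => y _.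
  rewrite !patchE; congr (if _ then _ else _).
  by apply/idP/idP => [/set_mem[]/= _ yH|/set_mem yH]; apply/mem_set.
apply: integral0_eq => y _; rewrite patchE ifF//; apply/negP => /set_mem[/= xH' _].
by apply: xH; apply/mem_set.
Qed.

(** Tonelli in one order on the left and in the other on the right; F itself need not be
    symmetric. *)
Lemma integral_halfspaceX_swap (F : V * V -> R) :
  measurable_fun setT F -> (forall z, 0 <= F z) ->
  (\int[mu \x mu]_(z in H `*` H) (F z)%:E =
   \int[mu \x mu]_(z in H `*` H) (F (z.2, z.1))%:E)%E.
Proof.
move=> mF F0; rewrite [LHS]integral_mkcond [RHS]integral_mkcond.
rewrite (fubini_tonelli1 _ (measurable_halfspaceX_restrict mF) (halfspaceX_restrict_ge0 F0)).
have mF' : measurable_fun setT (fun p : V * V => F (p.2, p.1)).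
  by apply: (measurableT_comp mF); exact: measurable_fun_pair.
have F'0 p : 0 <= F (p.2, p.1) by exact: F0.
rewrite (fubini_tonelli2 _ (measurable_halfspaceX_restrict mF') (halfspaceX_restrict_ge0 F'0)).
apply: eq_integral => x _; rewrite /fubini_F /fubini_G; apply: eq_integral => y _.
rewrite !patchE; congr (if _ then _ else _).
by apply/idP/idP => /set_mem[]/= ? ?; apply/mem_set.
Qed.

Definition erow : V := delta_mx 0 ord_max.

Lemma xlast_erow : xlast erow = 1.
Proof. by rewrite /= mxE !eqxx. Qed.

(** Since [x - xlast x *: erow] is (x',0), this is a dilation by the height of x followed by a
    horizontal translation. It preserves the halfspace and carries [erow] to x. *)
Definition half_affine x (z : V) : V := xlast x *: z + (x - xlast x *: erow).

Lemma xlast_half_affine x z : xlast (half_affine x z) = xlast x * xlast z.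
Proof. by rewrite /half_affine/= !mxE !eqxx mulr1 subrr addr0. Qed.

Lemma integral_half_affine x (g : V -> R) : 0 < xlast x ->
  measurable_fun setT g -> (forall z, 0 <= g z) ->
  (\int[mu]_(y in H) (g y)%:E =
   (xlast x ^+ n.+1)%:E * \int[mu]_(z in H) (g (half_affine x z))%:E)%E.
Proof.
move=> x0 mg g0; rewrite integral_mkcond (integral_rV_affine (x - xlast x *: erow) x0).
- congr (_ * _)%E; rewrite [RHS]integral_mkcond; apply: eq_integral => z _.
  rewrite !patchE; congr (if _ then _ else _).
  have e : xlast (half_affine x z) = xlast x * xlast z := xlast_half_affine x z.
  apply/idP/idP => /set_mem zH; apply/mem_set; move: zH;
    by rewrite /halfspace/= -!/(xlast (half_affine x z)) e pmulr_rgt0.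
- apply/(measurable_restrictT (fun z => (g z)%:E) measurable_halfspace).
  by apply: measurable_funTS; exact/measurable_EFinP.
- by move=> z; rewrite patchE; case: ifP => // _; rewrite lee_fin.
Qed.

(* F becomes a product once y is replaced by its coordinates in the frame at x. *)
Lemma integral_halfspaceX_prod (F : V * V -> R) (P Q : V -> R) :
  measurable_fun setT F -> (forall z, 0 <= F z) ->
  measurable_fun setT P -> (forall z, 0 <= P z) ->
  measurable_fun setT Q -> (forall z, 0 <= Q z) ->
  (forall x z, H x -> H z ->
    xlast x ^+ n.+1 * F (x, half_affine x z) = P x * Q z) ->
  (\int[mu \x mu]_(z in H `*` H) (F z)%:E =
   \int[mu]_(x in H) (P x)%:E * \int[mu]_(z in H) (Q z)%:E)%E.
Proof.
move=> mF F0 mP P0 mQ Q0 FPQ; rewrite integral_halfspaceX//.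
rewrite -ge0_integralZr//.
- apply: eq_integral => x /set_mem xH.
  rewrite (@integral_half_affine x (fun y => F (x, y)))//; last first.
    by apply: (measurableT_comp mF); exact: measurable_fun_pair.
  rewrite -ge0_integralZl//.
  + rewrite -ge0_integralZl//.
    * apply: eq_integral => z /set_mem zH.
      by rewrite -!EFinM FPQ.
    * by apply: measurable_funTS; exact/measurable_EFinP.
    * by move=> z _; rewrite lee_fin.
    * by rewrite lee_fin.
  + apply: measurable_funTS; apply/measurable_EFinP.
    apply: (measurableT_comp mF); apply: measurable_fun_pair => //.
    exact: measurable_rV_affine.
  + by move=> z _; rewrite lee_fin.
  + by rewrite lee_fin exprn_ge0// ltW.
- by apply: measurable_funTS; exact/measurable_EFinP.
- by move=> z _; rewrite lee_fin.
- by apply: integral_ge0 => z _; rewrite lee_fin.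
Qed.

End halfspace_integrals.

(** At every point f lies below the sum of all g k, and that series has integral at most C/(1-t).
    Together with cubes this takes the place of polar coordinates for radial singularities and
    tails. *)
Lemma integral_lty_geometric d (T : measurableType d) (R : realType)
    (m : {measure set T -> \bar R}) (D : set T) (f : T -> R) (g : nat -> T -> R)
    (C t : R) :
  measurable D -> measurable_fun D f -> (forall x, D x -> 0 <= f x) ->
  (forall k, measurable_fun D (g k)) -> (forall k x, D x -> 0 <= g k x) ->
  0 <= C -> 0 < t < 1 ->
  (forall k, \int[m]_(x in D) (g k x)%:E <= (C * t ^+ k)%:E)%E ->
  (forall x, D x -> exists k, f x <= g k x) ->
  (\int[m]_(x in D) (f x)%:E < +oo)%E.
Proof.
move=> mD mf f0 mg g0 C0 /andP[t0 t1] gC fg.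
have mgE k : measurable_fun D (EFin \o g k) by exact/measurable_EFinP.
have gE0 k x : D x -> (0 <= (g k x)%:E)%E by move=> Dx; rewrite lee_fin g0.
apply: (@le_lt_trans _ _ (\int[m]_(x in D) \sum_(0 <= k <oo) (g k x)%:E)%E).
  apply: ge0_le_integral => //.
  - exact/measurable_EFinP.
  - have := @ge0_emeasurable_sum _ _ _ D (fun k => EFin \o g k) xpredT.
    by apply => // k x Dx _; exact: gE0.
  - move=> x Dx; have [k fk] := fg x Dx.
    apply: (@le_trans _ _ (g k x)%:E); first by rewrite lee_fin.
    apply: le_trans (nneseries_lim_ge k.+1 _); last first.
      by move=> i _ _; exact: gE0.
    rewrite big_nat_recr//= leeDr// sume_ge0// => i _; exact: gE0.
rewrite integral_nneseries//.
apply: (@le_lt_trans _ _ (C * (1 - t)^-1)%:E); last exact: ltry.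
apply: lime_le.
  by apply: is_cvg_nneseries => k _ _; apply: integral_ge0 => x Dx; exact: gE0.
apply: nearW => k; apply: (@le_trans _ _ (\sum_(0 <= i < k) (C * t ^+ i)%:E)%E).
  exact: lee_sum.
rewrite sumEFin lee_fin; apply: (@geometric_le_lim _ k C t) => //.
by rewrite ger0_norm// ltW.
Qed.

Section cubes.
Variables (R : realType) (n : nat).

Definition cube (x : 'rV[R]_n) (r : R) : set 'rV[R]_n :=
  [set z | forall i, x 0 i - r <= z 0 i <= x 0 i + r].

Lemma measurable_cube x r : measurable (cube x r).
Proof.
rewrite [X in measurable X](_ : _ =
    [set z : 'rV[R]_n | forall i, `[x 0 i - r, x 0 i + r]%classic (z 0 i)]).
  by apply: (@measurable_rV_box _ _ (fun i => `[x 0 i - r, x 0 i + r]%classic)).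
by apply/seteqP; split => z /= h i; have := h i; rewrite in_itv.
Qed.

Lemma lebesgue_cube x r : 0 <= r -> lebesgue_rV R n (cube x r) = ((2 * r) ^+ n)%:E.
Proof.
move=> r0.
rewrite (_ : cube _ _ =
    [set z : 'rV[R]_n | forall i, `[x 0 i - r, x 0 i + r]%classic (z 0 i)]).
  rewrite (@lebesgue_rV_box _ _ (fun i => `[x 0 i - r, x 0 i + r]%classic))//.
  under eq_bigr => i _.
    rewrite lebesgue_measure_itv/= lte_fin.
    rewrite (_ : (if _ then _ else _) = (2 * r)%:E); last first.
      case: ifPn => [_|]; first by rewrite -EFinB; congr EFin; lra.
      by rewrite -leNgt => h; congr EFin; lra.
    over.
  by rewrite prodEFin prodr_const card_ord.
by apply/seteqP; split => z /= h i; have := h i; rewrite in_itv.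
Qed.

Lemma integral_indic_cube x r : 0 <= r ->
  (\int[lebesgue_rV R n]_z (\1_(cube x r) z)%:E = ((2 * r) ^+ n)%:E)%E.
Proof.
move=> r0; rewrite integral_indic//; last exact: measurable_cube.
by rewrite setIT; exact: lebesgue_cube.
Qed.

End cubes.

(** * The Riesz kernel *)

Lemma dyadic_scale (R : realType) (s : R) : 0 < s <= 1 ->
  exists k, 2^-1 ^+ k.+1 < s <= 2^-1 ^+ k.
Proof.
move=> /andP[s0 s1].
have ex : exists k, 2^-1 ^+ k.+1 < s.
  (* With j the truncation of 1/s, 1/s < j+1 < 2^(j+1). *)
  exists (Num.truncn (s^-1)).
  have h := truncnS_gt s^-1.
  rewrite exprVn invf_plt ?posrE ?exprn_gt0//; apply: (lt_trans h).
  by rewrite -natrX ltr_nat ltn_expl.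
(* Minimality of k supplies the upper bound; for k = 0 that bound is s <= 1. *)
case: (ex_minnP ex) => k ks kmin; exists k; rewrite ks/=.
case: k ks kmin => [|k] ks kmin; first by rewrite expr0.
by rewrite leNgt; apply/negP => /kmin; rewrite ltnn.
Qed.

Section kernel.
Variables (R : realType) (n : nat) (alpha : R).
Local Notation V := 'rV[R]_n.+1.
Local Notation mu := (lebesgue_rV R n.+1).
Local Notation H := (@halfspace R n.+1).
Local Notation e := (@erow R n).

(** The ground state: it is multiplicative under [half_affine], and its square divided by x_n^alpha
    is x_n^-1. *)
Definition hardy_weight (x : V) : R := xlast x `^ ((alpha - 1) / 2).

Definition riesz_kernel (x y : V) : R :=
  (enorm (x - y) `^ (n.+1%:R + alpha))^-1.

Local Notation w := hardy_weight.
Local Notation ker := riesz_kernel.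

(** A common majorant for the integrals in the frame at e: the minimum accounts for quadratic
    vanishing at e, and 1 + w covers the integrands with and without the weight. *)
Definition near_kernel (z : V) : R :=
  (1 + w z) * Num.min 1 (enorm (z - e) ^+ 2) * ker z e.

Lemma hardy_weight_ge0 x : 0 <= w x.
Proof. exact: powR_ge0. Qed.

Lemma hardy_weight_gt0 x : H x -> 0 < w x.
Proof. by move=> x0; exact: powR_gt0. Qed.

Lemma riesz_kernel_ge0 x y : 0 <= ker x y.
Proof. by rewrite invr_ge0 powR_ge0. Qed.

Lemma riesz_kernelC x y : ker x y = ker y x.
Proof. by rewrite /ker enorm_distC. Qed.

Lemma near_kernel_ge0 z : 0 <= near_kernel z.
Proof.
rewrite /near_kernel !mulr_ge0 ?riesz_kernel_ge0// ?addr_ge0 ?hardy_weight_ge0//.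
by rewrite le_min ler01 sqr_ge0.
Qed.

Lemma measurable_hardy_weight : measurable_fun setT w.
Proof. exact: (measurableT_comp (measurable_powR _) (@measurable_xlast R n)). Qed.

Lemma measurable_riesz_kernel d (T : measurableType d) (f g : T -> V) :
  measurable_fun setT f -> measurable_fun setT g ->
  measurable_fun setT (fun t => ker (f t) (g t)).
Proof.
move=> mf mg; apply: measurable_inv_ge0; last by move=> t; exact: powR_ge0.
apply: (measurableT_comp (measurable_powR _)).
by apply: (measurableT_comp (@measurable_enorm R n.+1)); exact: measurable_rVB.
Qed.

Lemma measurable_near_kernel : measurable_fun setT near_kernel.
Proof.
apply: measurable_funM; last exact: measurable_riesz_kernel.
apply: measurable_funM.
  by apply: measurable_funD => //; exact: measurable_hardy_weight.
apply: measurable_minr => //; apply: measurable_funX.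
by apply: (measurableT_comp (@measurable_enorm R n.+1)); exact: measurable_rVB.
Qed.

Hypotheses (alpha_gt1 : 1 < alpha) (alpha_lt2 : alpha < 2).

Lemma xlast_le z : xlast z <= 1 + enorm (z - e).
Proof.
have := ler_coord_enorm (z - e) ord_max; rewrite !mxE !eqxx/= => h.
have /= := le_trans (ler_norm _) h; rewrite /xlast; lra.
Qed.

(** With s = |z - e|, the height of z is at most 1 + s. For s <= 1 this gives 1 + w <= 3 and the
    power s^(2-alpha). For s > 1 it gives 1 + w <= 3 s^((alpha-1)/2), and (alpha-1)/2 - alpha <=
    alpha - 2 because alpha > 1, so one exponent serves both ends. *)
Lemma near_kernel_le z : H z -> 0 < enorm (z - e) ->
  near_kernel z <= 3 * (enorm (z - e) ^+ n.+1)^-1 *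
    Num.min (enorm (z - e)) (enorm (z - e))^-1 `^ (2 - alpha).
Proof.
have [a1 a2] := (alpha_gt1, alpha_lt2).
move=> zH; rewrite /near_kernel /ker; set s := enorm (z - e) => s0.
have z0 : 0 < xlast z by [].
have zs : xlast z <= 1 + s by exact: xlast_le.
have b0 : 0 <= (alpha - 1) / 2 by lra.
have -> : (s `^ (n.+1%:R + alpha))^-1 = (s ^+ n.+1)^-1 * s `^ (- alpha).
  by rewrite powRN -powR_mulrn ?(ltW s0)// -invfM -powRD// (gt_eqF s0) implybT.
have sN : 0 < (s ^+ n.+1)^-1 by rewrite invr_gt0 exprn_gt0.
have p2 : 2 `^ ((alpha - 1) / 2) <= 2 :> R.
  by rewrite -[leRHS]powRr1//; apply: ler_powR; lra.
rewrite mulrCA [3 * _]mulrC -[leRHS]mulrA ler_pM2l//.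
have [s1|s1] := leP s 1.
- have -> : Num.min s s^-1 = s by apply/min_idPl; rewrite (le_trans s1)// invf_ge1.
  have -> : Num.min 1 (s ^+ 2) = s ^+ 2 by apply/min_idPr; rewrite exprn_ile1 ?(ltW s0).
  have -> : s `^ (2 - alpha) = s ^+ 2 * s `^ (- alpha).
    by rewrite -powR_mulrn ?(ltW s0)// -powRD// (gt_eqF s0) implybT.
  rewrite [leRHS]mulrA ler_wpM2r ?powR_ge0// ler_wpM2r ?sqr_ge0//.
  suff : w z <= 2 by lra.
  by apply: le_trans p2; apply: ge0_ler_powR; rewrite ?nnegrE//; lra.
- have s1' := ltW s1.
  have -> : Num.min s s^-1 = s^-1.
    by apply/min_idPr; rewrite (le_trans _ s1')// invf_le1.
  have -> : Num.min 1 (s ^+ 2) = 1 by apply/min_idPl; rewrite exprn_ege1.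
  have -> : s^-1 `^ (2 - alpha) = s `^ (alpha - 2).
    by rewrite -powR_inv1 ?(ltW s0)// -powRrM; congr powR; lra.
  rewrite mulr1 (@le_trans _ _ (3 * s `^ ((alpha - 1) / 2) * s `^ (- alpha)))//.
    rewrite ler_wpM2r ?powR_ge0//.
    have sb : 1 <= s `^ ((alpha - 1) / 2) by have := ler_powR s1' b0; rewrite powRr0.
    suff : w z <= 2 * s `^ ((alpha - 1) / 2) by lra.
    apply: (@le_trans _ _ ((2 * s) `^ ((alpha - 1) / 2))).
      by apply: ge0_ler_powR; rewrite ?nnegrE//; lra.
    by rewrite powRM ?(ltW s0)// ler_wpM2r// powR_ge0.
  rewrite -mulrA -powRD ?(gt_eqF s0) ?implybT// ler_pM2l//.
  by apply: ler_powR => //; lra.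
Qed.

Lemma integral_near_kernel_lty : (\int[mu]_(z in H) (near_kernel z)%:E < +oo)%E.
Proof.
have [a1 a2] := (alpha_gt1, alpha_lt2).
pose t : R := 2^-1 `^ (2 - alpha).
(* [A k] bounds the kernel on the shell 2^-(k+1) < s <= 2^-k and [B k] on 2^k <= s < 2^(k+1).
   Multiplied by the volume of the cube around the shell, each gives 3 * 4^(n+1) * t^k, whence the
   constant 6 * 4^(n+1). *)
pose A k : R := 3 * t ^+ k * 2 ^+ (k.+1 * n.+1).
pose B k : R := 3 * t ^+ k * 2^-1 ^+ (k * n.+1).
have t0 : 0 < t by rewrite powR_gt0.
have A0 k : 0 <= A k by rewrite !mulr_ge0 ?exprn_ge0// ltW.
have B0 k : 0 <= B k by rewrite !mulr_ge0 ?exprn_ge0// ltW.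
have h0 k : 0 <= 2^-1 ^+ k :> R by rewrite exprn_ge0.
have d0 k : 0 <= 2 ^+ k :> R by rewrite exprn_ge0.
have mcube (x : V) r : measurable_fun setT (\1_(cube x r) : V -> R).
  by apply: measurable_indic; exact: measurable_cube.
have tk (u : R) k : 0 < u <= 2^-1 ^+ k -> u `^ (2 - alpha) <= t ^+ k.
  move=> /andP[u0 uk]; apply: (@le_trans _ _ ((2^-1 ^+ k) `^ (2 - alpha))).
    by apply: ge0_ler_powR; rewrite ?nnegrE ?(ltW u0)//; lra.
  have hk : 2^-1 ^+ k = 2^-1 `^ k%:R :> R by rewrite powR_mulrn.
  have -> : t ^+ k = t `^ k%:R by rewrite powR_mulrn// ltW.
  by rewrite hk /t -!powRrM mulrC.
apply: (@integral_lty_geometric _ _ _ mu H near_kernel (fun k z =>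
   A k * \1_(cube e (2^-1 ^+ k)) z + B k * \1_(cube e (2 ^+ k.+1)) z)
   (6 * 4 ^+ n.+1) t).
- exact: measurable_halfspace.
- exact: measurable_funTS measurable_near_kernel.
- by move=> x _; exact: near_kernel_ge0.
- by move=> k; apply: measurable_funTS; apply: measurable_funD; apply: measurable_funM.
- by move=> k x _; rewrite addr_ge0// mulr_ge0.
- by rewrite mulr_ge0// exprn_ge0.
- rewrite t0/= /t.
  have g0 : 0 < 2 - alpha by lra.
  have h1 : 2^-1 < 1 :> R by lra.
  by have := gt0_ltr_powR g0 _ _ h1; rewrite powR1 !nnegrE; apply; lra.
- move=> k; apply: (@le_trans _ _ (\int[mu]_z
    (A k * \1_(cube e (2^-1 ^+ k)) z + B k * \1_(cube e (2 ^+ k.+1)) z)%:E)%E).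
    apply: ge0_subset_integral => //; first exact: measurable_halfspace.
      by apply/measurable_EFinP; apply: measurable_funD; apply: measurable_funM.
    by move=> x _; rewrite lee_fin addr_ge0// mulr_ge0.
  under eq_integral do rewrite EFinD [(A k * _)%:E]EFinM [(B k * _)%:E]EFinM.
  rewrite ge0_integralD//; last 4 first.
  + by move=> x _; rewrite -EFinM lee_fin mulr_ge0.
  + by apply/measurable_EFinP; apply: measurable_funM.
  + by move=> x _; rewrite -EFinM lee_fin mulr_ge0.
  + by apply/measurable_EFinP; apply: measurable_funM.
  rewrite !ge0_integralZl ?lee_fin//; try exact/measurable_EFinP.
  rewrite !integral_indic_cube// -!EFinM -EFinD lee_fin /A /B.
  have hk : 2 ^+ k * 2^-1 ^+ k = 1 :> R by rewrite -exprMn divff// expr1n.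
  rewrite !exprM -!mulrA -!exprMn.
  have -> : 2 ^+ k.+1 * (2 * 2^-1 ^+ k) = 4 :> R.
    by rewrite exprS mulrACA hk mulr1 -natrM.
  have -> : 2^-1 ^+ k * (2 * 2 ^+ k.+1) = 4 :> R.
    by rewrite exprS [2^-1 ^+ k * _]mulrC -!mulrA hk mulr1 -natrM.
  rewrite le_eqVlt; apply/orP; left; apply/eqP; ring.
- move=> z zH; set s := enorm (z - e).
  have := enorm_ge0 (z - e); rewrite le_eqVlt => /orP[/eqP s0|s0].
    (* At z = e the minimum is 0, so any k would do. *)
    exists 0%N; have -> : near_kernel z = 0.
      rewrite /near_kernel -s0 expr2 mul0r.
      by rewrite (_ : Num.min 1 0 = 0) ?mulr0 ?mul0r//; apply/min_idPr.
    by rewrite addr_ge0 ?mulr_ge0.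
  have cz r : s <= r -> \1_(cube e r) z = 1 :> R.
    move=> sr; rewrite indicE mem_set// => i.
    have := le_trans (ler_coord_enorm (z - e) i) sr.
    by rewrite !mxE ler_norml => /andP[? ?]; apply/andP; split; lra.
  have [s1|s1] := leP s 1.
    have [k /andP[ks sk]] := @dyadic_scale R s ltac:(by rewrite s0).
    exists k; rewrite cz// mulr1 -[leLHS]addr0 lerD //; last by rewrite mulr_ge0.
    apply: (le_trans (near_kernel_le zH s0)).
    rewrite /A -mulrA -[leRHS]mulrA ler_pM2l// mulrC; apply: ler_pM => //.
    + exact: powR_ge0.
    + by rewrite invr_ge0 exprn_ge0// enorm_ge0.
    + have -> : Num.min s s^-1 = s by apply/min_idPl; rewrite (le_trans s1)// invf_ge1.
      by apply: tk; rewrite s0.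
    + rewrite exprM -[leLHS]exprVn lerXn2r ?nnegrE ?invr_ge0 ?enorm_ge0//.
      by rewrite -[leRHS]invrK lef_pV2 ?posrE ?invr_gt0 ?exprn_gt0// -exprVn ltW.
  have s1' : 0 < s^-1 <= 1.
    by rewrite invr_gt0 (s0 : 0 < s)/= invf_le1 ?(s0 : 0 < s) //; exact: ltW.
  (* Outside the unit ball the dyadic scale is that of 1/s. *)
  have [k /andP[ks sk]] := dyadic_scale s1'.
  exists k; rewrite [\1_(cube _ (2 ^+ _)) _]cz; last first.
    by rewrite -[leRHS]invrK -[leLHS]invrK lef_pV2 ?posrE ?invr_gt0 ?exprn_gt0// -exprVn ltW.
  rewrite mulr1 -[leLHS]add0r lerD //; first by rewrite mulr_ge0.
  apply: (le_trans (near_kernel_le zH s0)).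
  rewrite /B -mulrA -[leRHS]mulrA ler_pM2l// mulrC; apply: ler_pM => //.
  + exact: powR_ge0.
  + by rewrite invr_ge0 exprn_ge0// enorm_ge0.
  + have -> : Num.min s s^-1 = s^-1.
      by apply/min_idPr; rewrite (le_trans _ (ltW s1))// invf_le1 ?(ltW s1).
    by apply: tk; rewrite sk andbT invr_gt0.
  + by rewrite exprM -[leLHS]exprVn lerXn2r ?nnegrE ?invr_ge0 ?enorm_ge0.
Qed.

End kernel.

(** * The truncated ground state representation *)

Section ground_state.
Variables (R : realType) (n : nat) (alpha : R).
Hypotheses (alpha_gt1 : 1 < alpha) (alpha_lt2 : alpha < 2).
Local Notation V := 'rV[R]_n.+1.
Local Notation mu := (lebesgue_rV R n.+1).
Local Notation H := (@halfspace R n.+1).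
Local Notation e := (@erow R n).
Local Notation w := (@hardy_weight R n alpha).
Local Notation ker := (@riesz_kernel R n alpha).

Lemma half_affineB (x z : V) : x - half_affine x z = xlast x *: (e - z).
Proof.
by apply/rowP => i; rewrite /half_affine !mxE; ring.
Qed.

Lemma riesz_kernel_half_affine (x z : V) : H x ->
  ker x (half_affine x z) = (xlast x `^ (n.+1%:R + alpha))^-1 * ker e z.
Proof.
move=> x0; rewrite /riesz_kernel half_affineB enormZ; last exact: ltW.
by rewrite powRM ?enorm_ge0 ?invfM// ltW.
Qed.

Lemma hardy_weight_half_affine (x z : V) : H x -> H z ->
  w (half_affine x z) = w x * w z.
Proof.
by move=> x0 z0; rewrite /hardy_weight xlast_half_affine powRM// ltW.
Qed.

Definition scale_invariant (t : V * V -> R) := forall x z, H x -> H z ->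
  t (x, half_affine x z) = t (e, z).

Lemma measurable_hardy_integrand (f : V -> R) : measurable_fun setT f ->
  measurable_fun setT (fun x => `|f x| ^+ 2 / xlast x `^ alpha).
Proof.
move=> mf; apply: measurable_funM.
  by apply: measurable_funX; exact: measurableT_comp.
apply: measurable_inv_ge0; last by move=> x; exact: powR_ge0.
exact: (measurableT_comp (measurable_powR _) (@measurable_xlast R n)).
Qed.

Lemma hardy_integrand_ge0 (f : V -> R) x : 0 <= `|f x| ^+ 2 / xlast x `^ alpha.
Proof. by rewrite divr_ge0 ?powR_ge0 ?exprn_ge0. Qed.

(** In the frame at x the kernel contributes x_n^-(n+1+alpha) and the Jacobian x_n^(n+1), as [n.+1]
    is the dimension. What remains is x_n^-alpha times a function of z. *)
Lemma integral_scale_invariant (f : V -> R) (t : V * V -> R) :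
  measurable_fun setT f -> measurable_fun setT t -> (forall p, 0 <= t p) ->
  scale_invariant t ->
  (\int[mu \x mu]_(p in H `*` H) (`|f p.1| ^+ 2 * (t p * ker p.1 p.2))%:E =
   hardy_integral alpha f * \int[mu]_(z in H) (t (e, z) * ker e z)%:E)%E.
Proof.
move=> mf mt t0 tinv; apply: integral_halfspaceX_prod.
- apply: measurable_funM.
    apply: measurable_funX; apply: measurableT_comp => //.
    exact: (measurableT_comp mf).
  by apply: measurable_funM => //; exact: measurable_riesz_kernel.
- by move=> p; rewrite !mulr_ge0 ?exprn_ge0 ?riesz_kernel_ge0.
- exact: measurable_hardy_integrand.
- exact: hardy_integrand_ge0.
- apply: measurable_funM; last exact: measurable_riesz_kernel.
  by apply: (measurableT_comp mt); exact: measurable_fun_pair.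
- by move=> z; rewrite mulr_ge0 ?riesz_kernel_ge0.
- move=> x z x0 z0; rewrite [_.1]/= [_.2]/= (tinv _ _ x0 z0) (riesz_kernel_half_affine z x0).
  have xlt0 : 0 < xlast x by [].
  rewrite powRD ?(gt_eqF xlt0) ?implybT// powR_mulrn ?(ltW xlt0)// invfM.
  have /gt_eqF/negbT xn0 : 0 < xlast x ^+ n.+1 by exact: exprn_gt0.
  move: (ker e z) (_ `^ _)^-1 (_ ^+ n.+1) xn0 => k p d d0.
  by field.
Qed.

(** As before; in addition w y / w x becomes w z, because w is multiplicative under
    [half_affine]. *)
Lemma integral_scale_invariant_weight (f : V -> R) (t : V * V -> R) :
  measurable_fun setT f -> measurable_fun setT t -> (forall p, 0 <= t p) ->
  scale_invariant t ->
  (\int[mu \x mu]_(p in H `*` H)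
     (`|f p.1| ^+ 2 * (w p.2 / w p.1) * (t p * ker p.1 p.2))%:E =
   hardy_integral alpha f * \int[mu]_(z in H) (w z * (t (e, z) * ker e z))%:E)%E.
Proof.
move=> mf mt t0 tinv; apply: integral_halfspaceX_prod.
- apply: measurable_funM.
    apply: measurable_funM.
      apply: measurable_funX; apply: measurableT_comp => //.
      exact: (measurableT_comp mf).
    apply: measurable_funM.
      exact: (measurableT_comp (@measurable_hardy_weight R n alpha)).
    apply: measurable_inv_ge0; last by move=> p; exact: hardy_weight_ge0.
    exact: (measurableT_comp (@measurable_hardy_weight R n alpha)).
  by apply: measurable_funM => //; exact: measurable_riesz_kernel.
- by move=> p; rewrite !mulr_ge0 ?exprn_ge0 ?riesz_kernel_ge0 ?invr_ge0 ?hardy_weight_ge0.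
- exact: measurable_hardy_integrand.
- exact: hardy_integrand_ge0.
- apply: measurable_funM; first exact: measurable_hardy_weight.
  apply: measurable_funM; last exact: measurable_riesz_kernel.
  by apply: (measurableT_comp mt); exact: measurable_fun_pair.
- by move=> z; rewrite !mulr_ge0 ?riesz_kernel_ge0 ?hardy_weight_ge0.
- move=> x z x0 z0; rewrite [_.1]/= [_.2]/= (tinv _ _ x0 z0) (riesz_kernel_half_affine z x0).
  rewrite (hardy_weight_half_affine x0 z0).
  have xlt0 : 0 < xlast x by [].
  have /gt_eqF/negbT wx0 : 0 < w x by exact: hardy_weight_gt0.
  rewrite powRD ?(gt_eqF xlt0) ?implybT// powR_mulrn ?(ltW xlt0)// invfM.
  have /gt_eqF/negbT xn0 : 0 < xlast x ^+ n.+1 by exact: exprn_gt0.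
  move: (ker e z) (_ `^ _)^-1 => k p.
  move: (w x) wx0 (w z) (_ ^+ n.+1) xn0 => a a0 c d d0.
  by field; rewrite a0 d0.
Qed.

Lemma integral_near_kernel_bound (t : V * V -> R) (C : R) :
  measurable_fun setT t -> (forall p, 0 <= t p) -> 0 <= C ->
  (forall z, H z -> t (e, z) <= C * Num.min 1 (enorm (z - e) ^+ 2)) ->
  (\int[mu]_(z in H) (t (e, z) * ker e z)%:E < +oo)%E /\
  (\int[mu]_(z in H) (w z * (t (e, z) * ker e z))%:E < +oo)%E.
Proof.
move=> mt t0 C0 tC.
have mte : measurable_fun setT (fun z => t (e, z) * ker e z).
  apply: measurable_funM; last exact: measurable_riesz_kernel.
  by apply: (measurableT_comp mt); exact: measurable_fun_pair.
have mH := @measurable_halfspace R n.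
have Koo : (\int[mu]_(z in H) (C * near_kernel alpha z)%:E < +oo)%E.
  under eq_integral do rewrite EFinM.
  rewrite ge0_integralZl//.
  - by rewrite lte_mul_pinfty// ?lee_fin// integral_near_kernel_lty.
  - by apply: measurable_funTS; apply/measurable_EFinP; exact: measurable_near_kernel.
  - by move=> z _; rewrite lee_fin near_kernel_ge0.
have mK : measurable_fun H (fun z => (C * near_kernel alpha z)%:E).
  apply: measurable_funTS; apply/measurable_EFinP.
  by apply: measurable_funM; [exact: measurable_cst|exact: measurable_near_kernel].
have tb z : H z -> t (e, z) * ker e z <= C * (Num.min 1 (enorm (z - e) ^+ 2) * ker z e).
  by move=> zH; rewrite mulrA (riesz_kernelC _ z) ler_wpM2r ?riesz_kernel_ge0 ?tC.
have m0 z : 0 <= Num.min 1 (enorm (z - e) ^+ 2) * ker z e.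
  by rewrite mulr_ge0 ?riesz_kernel_ge0// le_min ler01 sqr_ge0.
split; apply: le_lt_trans Koo; apply: (ge0_le_integral mu mH _ _ mK).
- by move=> z _; rewrite lee_fin mulr_ge0 ?riesz_kernel_ge0.
- by apply: measurable_funTS; apply/measurable_EFinP.
- move=> z zH; rewrite lee_fin; apply: (le_trans (tb z zH)).
  rewrite ler_wpM2l// /near_kernel -mulrA -[leLHS]mul1r ler_wpM2r//.
  by rewrite lerDl hardy_weight_ge0.
- by move=> z _; rewrite lee_fin !mulr_ge0 ?riesz_kernel_ge0 ?hardy_weight_ge0.
- apply: measurable_funTS; apply/measurable_EFinP; apply: measurable_funM => //.
  exact: measurable_hardy_weight.
- move=> z zH; rewrite lee_fin.
  apply: (@le_trans _ _ (w z * (C * (Num.min 1 (enorm (z - e) ^+ 2) * ker z e)))).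
    by rewrite ler_wpM2l ?hardy_weight_ge0 ?tb.
  rewrite mulrCA ler_wpM2l// /near_kernel -mulrA ler_wpM2r//.
  by rewrite lerDr.
Qed.

(** The absolute value keeps the function nonnegative on the whole space, where measurability and
    Tonelli are applied before restricting to the halfspace. *)
Definition trunc (m : nat) (p : V * V) : R :=
  Num.min 1 (m%:R * (enorm (p.1 - p.2) ^+ 2 / `|xlast p.1 * xlast p.2|)).

Lemma trunc_ge0 m p : 0 <= trunc m p.
Proof. by rewrite le_min ler01 mulr_ge0// divr_ge0// sqr_ge0. Qed.

Lemma trunc_le1 m p : trunc m p <= 1.
Proof. by rewrite ge_min lexx. Qed.

Lemma truncC m x y : trunc m (x, y) = trunc m (y, x).
Proof. by rewrite /trunc/= enorm_distC mulrC [X in `|X|]mulrC mulrC. Qed.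

Lemma trunc_nd m k p : (m <= k)%N -> trunc m p <= trunc k p.
Proof.
move=> mk; rewrite /trunc le_min ge_min lexx/=.
rewrite ge_min; apply/orP; right; rewrite ler_wpM2r ?ler_nat//.
by rewrite divr_ge0// sqr_ge0.
Qed.

Lemma measurable_trunc m : measurable_fun setT (trunc m).
Proof.
apply: measurable_minr => //; apply: measurable_funM => //.
apply: measurable_funM.
  apply: measurable_funX; apply: (measurableT_comp (@measurable_enorm R n.+1)).
  exact: measurable_rVB.
apply: measurable_inv_ge0 => //; apply: measurableT_comp => //.
by apply: measurable_funM; exact: (measurableT_comp (@measurable_xlast R n)).
Qed.

Lemma scale_invariant_trunc m : scale_invariant (trunc m).
Proof.
move=> x z x0 z0; rewrite /trunc; congr (Num.min _ (_ * _)).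
rewrite ![(_, _).1]/= ![(_, _).2]/= half_affineB enormZ; last exact: ltW.
rewrite xlast_half_affine xlast_erow mul1r.
have xlt0 : 0 < xlast x by [].
have zlt0 : 0 < xlast z by [].
rewrite !ger0_norm ?mulr_ge0 ?(ltW xlt0) ?(ltW zlt0)//.
move: (enorm _) (xlast x) (xlast z) xlt0 zlt0 => s a c a0 c0.
by field; rewrite !gt_eqF.
Qed.

(** If s = |z - e| >= 1/2, the minimum on the right is at least 1/4 and the summand 4 suffices. If s
    < 1/2, the height of z is at least 1/2 and the summand 2m suffices. *)
Lemma trunc_bound m z : H z ->
  trunc m (e, z) <= (4 + 2 * m%:R) * Num.min 1 (enorm (z - e) ^+ 2).
Proof.
move=> z0; rewrite /trunc ![(_, _).1]/= ![(_, _).2]/= enorm_distC xlast_erow mul1r.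
set s := enorm _.
have zlt0 : 0 < xlast z by [].
have s0 : 0 <= s by exact: enorm_ge0.
have m0 : 0 <= m%:R :> R by [].
rewrite ger0_norm ?(ltW zlt0)//.
have [s1|s1] := leP (2^-1) s.
  have h : 4^-1 <= Num.min 1 (s ^+ 2).
    by rewrite le_min; apply/andP; split; [lra|rewrite expr2; nra].
  apply: (@le_trans _ _ 1); first by rewrite ge_min lexx.
  by move: (Num.min _ _) h => M h; nra.
have zl : 2^-1 <= xlast z.
  have := ler_coord_enorm (z - e) ord_max; rewrite !mxE !eqxx/= -/s ler_norml.
  by rewrite /xlast; lra.
have -> : Num.min 1 (s ^+ 2) = s ^+ 2 by apply/min_idPr; rewrite expr2; nra.
rewrite ge_min; apply/orP; right.
rewrite mulrA ler_pdivrMr// -subr_ge0.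
have := sqr_ge0 s; move: (s ^+ 2) (xlast z) zl m0 => S c c2; move: (m%:R) => M M0 S0.
have : 0 <= S * M * (2 * c - 1) by rewrite !mulr_ge0//; lra.
have : 0 <= S * c by rewrite !mulr_ge0//; lra.
nra.
Qed.

End ground_state.

(** * The truncated energies and their exact identity *)

Section trunc_energy.
Variables (R : realType) (n : nat) (alpha : R).
Hypotheses (alpha_gt1 : 1 < alpha) (alpha_lt2 : alpha < 2).
Local Notation V := 'rV[R]_n.+1.
Local Notation mu := (lebesgue_rV R n.+1).
Local Notation H := (@halfspace R n.+1).
Local Notation e := (@erow R n).
Local Notation w := (@hardy_weight R n alpha).
Local Notation ker := (@riesz_kernel R n alpha).
Local Notation trunc := (@trunc R n).

Let mH : measurable H := @measurable_halfspace R n.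
Let mHH : measurable (H `*` H) := measurableX mH mH.

(** Monotone convergence: off the diagonal the truncation is eventually equal to 1, while on the
    diagonal it is always 0. Requiring F to vanish there gives convergence at every point, without
    showing that the diagonal is a null set. *)
Lemma cvg_trunc (F : V * V -> R) : measurable_fun setT F -> (forall p, 0 <= F p) ->
  (forall x, F (x, x) = 0) ->
  (\int[mu \x mu]_(p in H `*` H) (F p * trunc m p)%:E @[m --> \oo]
    --> \int[mu \x mu]_(p in H `*` H) (F p)%:E)%E.
Proof.
move=> mF F0 Fdiag.
have -> : (\int[mu \x mu]_(p in H `*` H) (F p)%:E =
  \int[mu \x mu]_(p in H `*` H) limn (fun m => (F p * trunc m p)%:E))%E.
  apply: eq_integral => -[x y] /set_mem[/= x0 y0]; apply/esym/cvg_lim => //.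
  have [xy|/eqP xy] := eqVneq x y.
    rewrite -xy Fdiag; apply: cvg_near_cst; apply: nearW => m.
    by rewrite mul0r.
  have s0 : 0 < enorm (x - y).
    rewrite lt_neqAle enorm_ge0 andbT eq_sym; apply/eqP => /enorm_eq0/eqP.
    by rewrite subr_eq0 => /eqP.
  have q0 : 0 < enorm (x - y) ^+ 2 / `|xlast x * xlast y|.
    by rewrite divr_gt0 ?exprn_gt0// normr_gt0 mulf_neq0// gt_eqF.
  apply: cvg_near_cst; near=> m.
  rewrite (_ : trunc m (x, y) = 1) ?mulr1//; apply/min_idPl => /=.
  rewrite -ler_pdivrMr// div1r.
  by near: m; exact: nbhs_infty_ger.
apply: cvg_monotone_convergence => //.
- move=> m; apply: measurable_funTS; apply/measurable_EFinP.
  by apply: measurable_funM => //; exact: measurable_trunc.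
- by move=> m p _; rewrite lee_fin mulr_ge0// trunc_ge0.
- by move=> p _ m k mk; rewrite lee_fin ler_wpM2l// trunc_nd.
Unshelve. all: by end_near. Qed.

Definition energy_density (f : V -> R) (p : V * V) : R :=
  `|f p.1 - f p.2| ^+ 2 * ker p.1 p.2.

Definition ground_density (f : V -> R) (p : V * V) : R :=
  w p.1 * w p.2 * `|f p.1 / w p.1 - f p.2 / w p.2| ^+ 2 * ker p.1 p.2.

Lemma energy_density_ge0 f p : 0 <= energy_density f p.
Proof. by rewrite mulr_ge0 ?exprn_ge0 ?riesz_kernel_ge0. Qed.

Lemma ground_density_ge0 f p : 0 <= ground_density f p.
Proof. by rewrite !mulr_ge0 ?exprn_ge0 ?riesz_kernel_ge0 ?hardy_weight_ge0. Qed.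

Lemma measurable_comp_fst (f : V -> R) : measurable_fun setT f ->
  measurable_fun setT (fun p : V * V => f p.1).
Proof. by move=> mf; exact: (measurableT_comp mf). Qed.

Lemma measurable_comp_snd (f : V -> R) : measurable_fun setT f ->
  measurable_fun setT (fun p : V * V => f p.2).
Proof. by move=> mf; exact: (measurableT_comp mf). Qed.

Lemma measurable_energy_density f : measurable_fun setT f ->
  measurable_fun setT (energy_density f).
Proof.
move=> mf; apply: measurable_funM; last exact: measurable_riesz_kernel.
apply: measurable_funX; apply: measurableT_comp => //.
by apply: measurable_funB; [exact: measurable_comp_fst|exact: measurable_comp_snd].
Qed.

Let mw := @measurable_hardy_weight R n alpha.

Lemma measurable_div_weight (f : V -> R) : measurable_fun setT f ->
  measurable_fun setT (fun x => f x / w x).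
Proof.
move=> mf; apply: measurable_funM => //; apply: measurable_inv_ge0 => //.
exact: hardy_weight_ge0.
Qed.

Lemma measurable_ground_density f : measurable_fun setT f ->
  measurable_fun setT (ground_density f).
Proof.
move=> mf; apply: measurable_funM; last exact: measurable_riesz_kernel.
apply: measurable_funM.
  by apply: measurable_funM; [exact: measurable_comp_fst|exact: measurable_comp_snd].
apply: measurable_funX; apply: measurableT_comp => //.
apply: measurable_funB.
  exact: (measurable_comp_fst (measurable_div_weight mf)).
exact: (measurable_comp_snd (measurable_div_weight mf)).
Qed.

Definition ground_energy f : \bar R :=
  (\int[mu \x mu]_(p in H `*` H) (ground_density f p)%:E)%E.

(** This is 2 \int (1 - w(z)) trunc(e,z) k(e,z) dz. The integrand changes sign at height 1, so it is
    written as a difference of two integrals of nonnegative functions, both finite by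
    [integral_near_kernel_bound]. *)
Definition trunc_potential m : R :=
  2 * (fine (\int[mu]_(z in H) (trunc m (e, z) * ker e z)%:E)%E -
       fine (\int[mu]_(z in H) (w z * (trunc m (e, z) * ker e z))%:E)%E).

Lemma integral_halfspaceX_symD (G : V * V -> R) : measurable_fun setT G ->
  (forall p, 0 <= G p) ->
  (\int[mu \x mu]_(p in H `*` H) (G p + G (p.2, p.1))%:E =
   \int[mu \x mu]_(p in H `*` H) (G p)%:E + \int[mu \x mu]_(p in H `*` H) (G p)%:E)%E.
Proof.
move=> mG G0; under eq_integral do rewrite EFinD.
rewrite ge0_integralD//.
- by congr (_ + _)%E; rewrite [RHS]integral_halfspaceX_swap.
- by move=> p _; rewrite lee_fin.
- by apply: measurable_funTS; apply/measurable_EFinP.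
- by move=> p _; rewrite lee_fin.
- apply: measurable_funTS; apply/measurable_EFinP.
  by apply: (measurableT_comp mG); exact: measurable_fun_pair.
Qed.

(* The ground state representation, with the kernel multiplied by trunc m so
   that all the integrals converge absolutely and no principal value is needed. *)
Lemma trunc_ground_state m f : measurable_fun setT f ->
  hardy_integral alpha f \is a fin_num ->
  (\int[mu \x mu]_(p in H `*` H) (energy_density f p * trunc m p)%:E =
   \int[mu \x mu]_(p in H `*` H) (ground_density f p * trunc m p)%:E +
   (trunc_potential m)%:E * hardy_integral alpha f)%E.
Proof.
move=> mf hfin.
(* E and J may be infinite here; only the finite potential terms are subtracted. *)
have alg (E J : \bar R) (h a b : R) :
    (E + (h * b + h * b)%:E = J + (h * a + h * a)%:E)%E ->
    E = (J + (2 * (a - b) * h)%:E)%E.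
  move=> EJ; rewrite -[LHS](@addeK _ (h * b + h * b)%:E)// EJ -addeA -EFinB.
  by congr (_ + _%:E)%E; ring.
have mt := @measurable_trunc R n m; have t0 := @trunc_ge0 R n m.
have tinv := @scale_invariant_trunc R n m.
have [] := integral_near_kernel_bound alpha_gt1 alpha_lt2 mt t0 _ (@trunc_bound R n m).
  by rewrite addr_ge0// mulr_ge0.
pose F1 (p : V * V) := `|f p.1| ^+ 2 * (trunc m p * ker p.1 p.2).
pose F2 (p : V * V) := `|f p.1| ^+ 2 * (w p.2 / w p.1) * (trunc m p * ker p.1 p.2).
rewrite /trunc_potential.
set A := (\int[mu]_(z in H) (trunc m (e, z) * ker e z)%:E)%E.
set B := (\int[mu]_(z in H) _)%E.
move=> Aoo Boo.
have Aint : (\int[mu \x mu]_(p in H `*` H) (F1 p)%:E = hardy_integral alpha f * A)%E.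
  exact: integral_scale_invariant.
have Bint : (\int[mu \x mu]_(p in H `*` H) (F2 p)%:E = hardy_integral alpha f * B)%E.
  exact: integral_scale_invariant_weight.
have Afin : A \is a fin_num.
  by rewrite ge0_fin_numE// integral_ge0// => z _; rewrite lee_fin mulr_ge0 ?riesz_kernel_ge0.
have Bfin : B \is a fin_num.
  rewrite ge0_fin_numE// integral_ge0// => z _.
  by rewrite lee_fin !mulr_ge0 ?riesz_kernel_ge0 ?hardy_weight_ge0.
have mk : measurable_fun setT (fun p : V * V => trunc m p * ker p.1 p.2).
  by apply: measurable_funM => //; exact: measurable_riesz_kernel.
have k0 p : 0 <= trunc m p * ker p.1 p.2 by rewrite mulr_ge0 ?riesz_kernel_ge0.
have mf2 : measurable_fun setT (fun p : V * V => `|f p.1| ^+ 2).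
  by apply: measurable_funX; apply: measurableT_comp => //; exact: measurable_comp_fst.
have mF1 : measurable_fun setT F1 by exact: measurable_funM.
have F10 p : 0 <= F1 p by rewrite /F1 mulr_ge0// exprn_ge0.
have mF2 : measurable_fun setT F2.
  apply: measurable_funM => //; apply: measurable_funM => //.
  apply: measurable_funM; first exact: measurable_comp_snd.
  apply: measurable_inv_ge0; last by move=> p; exact: hardy_weight_ge0.
  exact: measurable_comp_fst.
have F20 p : 0 <= F2 p.
  by rewrite /F2 mulr_ge0// mulr_ge0 ?exprn_ge0 ?divr_ge0 ?hardy_weight_ge0.
have mswap (G : V * V -> R) : measurable_fun setT G ->
    measurable_fun setT (fun p => G p + G (p.2, p.1)).
  move=> mG; apply: measurable_funD => //.
  by apply: (measurableT_comp mG); exact: measurable_fun_pair.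
have mE : measurable_fun setT (fun p => energy_density f p * trunc m p).
  by apply: measurable_funM => //; exact: measurable_energy_density.
have mJ : measurable_fun setT (fun p => ground_density f p * trunc m p).
  by apply: measurable_funM => //; exact: measurable_ground_density.
have E0 p : 0 <= energy_density f p * trunc m p.
  by rewrite mulr_ge0 ?energy_density_ge0.
have J0 p : 0 <= ground_density f p * trunc m p.
  by rewrite mulr_ge0 ?ground_density_ge0.
have splitD (G K : V * V -> R) : measurable_fun setT G -> (forall p, 0 <= G p) ->
    measurable_fun setT K -> (forall p, 0 <= K p) ->
    (\int[mu \x mu]_(p in H `*` H) (G p + (K p + K (p.2, p.1)))%:E =
     \int[mu \x mu]_(p in H `*` H) (G p)%:E + (\int[mu \x mu]_(p in H `*` H) (K p)%:E +
       \int[mu \x mu]_(p in H `*` H) (K p)%:E))%E.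
  move=> mG G0 mK K0; rewrite -integral_halfspaceX_symD//.
  under eq_integral do rewrite EFinD.
  rewrite ge0_integralD//.
  - by move=> p _; rewrite lee_fin.
  - by apply: measurable_funTS; apply/measurable_EFinP.
  - by move=> p _; rewrite lee_fin addr_ge0.
  - by apply: measurable_funTS; apply/measurable_EFinP; exact: mswap.
(* The pointwise identity, with a = f x and b = f y, is (a-b)^2 + a^2 w_y/w_x + b^2 w_x/w_y = w_x
   w_y (a/w_x - b/w_y)^2 + a^2 + b^2. All terms are nonnegative, so it integrates term by term. *)
have key : (\int[mu \x mu]_(p in H `*` H) (energy_density f p * trunc m p)%:E +
    (hardy_integral alpha f * B + hardy_integral alpha f * B) =
    \int[mu \x mu]_(p in H `*` H) (ground_density f p * trunc m p)%:E +
    (hardy_integral alpha f * A + hardy_integral alpha f * A))%E.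
  rewrite -Aint -Bint -!splitD//; apply: eq_integral => -[x y] /set_mem[/= x0 y0].
  congr EFin; rewrite /energy_density /ground_density /F1 /F2/=.
  rewrite (truncC _ y x) (riesz_kernelC _ y x) !real_normK ?num_real//.
  have /gt_eqF/negbT wx0 : 0 < w x by exact: hardy_weight_gt0.
  have /gt_eqF/negbT wy0 : 0 < w y by exact: hardy_weight_gt0.
  by move: (trunc m (x, y)) (ker x y) => t k; field; rewrite wx0 wy0.
rewrite -(fineK hfin) -EFinM; apply: alg.
by move: key; rewrite -(fineK Afin) -(fineK Bfin) -(fineK hfin) -!EFinM -!EFinD.
Qed.

End trunc_energy.

(** * The weighted Sobolev inequality *)

Section ground_sobolev.
Variables (R : realType) (n : nat) (alpha : R).
Hypotheses (alpha_gt1 : 1 < alpha) (alpha_lt2 : alpha < 2) (n_gt0 : (0 < n)%N).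
Local Notation V := 'rV[R]_n.+1.
Local Notation mu := (lebesgue_rV R n.+1).
Local Notation H := (@halfspace R n.+1).
Local Notation w := (@hardy_weight R n alpha).
Local Notation N := (n.+1%:R : R).

Let mH : measurable H := @measurable_halfspace R n.

Lemma sobolev_exponent (K : R) : 0 < K -> 0 < K - alpha ->
  2 * K / (K - alpha) * (alpha / K) = 2 * K / (K - alpha) - 2.
Proof. by move=> K0 Ka; field; rewrite !gt_eqF. Qed.

Lemma sobolev_exponentV (K : R) : 0 < K -> 0 < K - alpha ->
  2 / (2 * K / (K - alpha)) = - (alpha / K) + 1.
Proof. by move=> K0 Ka; field; rewrite !gt_eqF. Qed.

(** Chebyshev bounds the part of Q where |f| > s/2 by M (2/s)^q. The additive form avoids
    subtracting measures. *)
Lemma le_measure_good_part (Q : set V) (f : V -> R) (s q M : R) :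
  measurable Q -> measurable_fun setT f -> Q `<=` H -> 0 < s -> 0 < q ->
  (\int[mu]_(x in H) (`|f x| `^ q)%:E = M%:E)%E ->
  (mu Q <= mu (Q `&` [set y | `|f y| <= s / 2]%R) + (M * 2 `^ q / s `^ q)%:E)%E.
Proof.
move=> mQ mf QH s0 q0 IM.
have mnf : measurable_fun setT (fun y : V => `|f y|) by exact: measurableT_comp.
have mG : measurable [set y | `|f y| <= s / 2].
  rewrite (_ : [set y | _] = (fun y : V => `|f y|) @^-1` `]-oo, s / 2]%classic); last first.
    by apply/seteqP; split => y /=; rewrite in_itv.
  by rewrite -[X in measurable X]setTI; exact: mnf.
set G := [set y | _] in mG *.
have mB : measurable (Q `&` ~` G) by apply: measurableI => //; exact: measurableC.
have mfq : measurable_fun setT (fun y : V => (`|f y| `^ q)%:E).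
  by apply/measurable_EFinP; exact: (measurableT_comp (measurable_powR _) mnf).
have sq0 : 0 < (s / 2) `^ q by rewrite powR_gt0// divr_gt0.
have cheb : (((s / 2) `^ q)%:E * mu (Q `&` ~` G) <= M%:E)%E.
  rewrite -integral_cst// -IM.
  apply: (@le_trans _ _ (\int[mu]_(x in Q `&` ~` G) (`|f x| `^ q)%:E)%E).
    apply: ge0_le_integral => //.
    - by move=> x _; rewrite lee_fin powR_ge0.
    - exact: measurable_funTS.
    - move=> x [_ /= /negP]; rewrite -ltNge => /ltW h; rewrite lee_fin.
      by apply: ge0_ler_powR => //; rewrite ?nnegrE// ?ltW// divr_gt0.
  apply: ge0_subset_integral => //; first exact: measurable_funTS.
  by move=> x [/QH].
apply: (@le_trans _ _ (mu ((Q `&` G) `|` (Q `&` ~` G)))).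
  by rewrite -setIUr setUv setIT.
apply: (le_trans (measureU2 _ _ _)) => //; first exact: measurableI.
rewrite leeD2l//.
have -> : M * 2 `^ q / s `^ q = ((s / 2) `^ q)^-1 * M.
  rewrite powRM ?invr_ge0 ?(ltW s0)// -[2^-1]powR_inv1// -powRrM mulN1r powRN.
  by rewrite invfM invrK mulrC [M * _]mulrC mulrA.
by rewrite EFinM lee_pdivlMl.
Qed.

(* Since w is nondecreasing in x_n, on the cube with lower corner x the weight is
   at least w x; at the scale r where the cube holds more than twice the mass that
   Chebyshev allows to [|f| > |f x| / 2], half of the cube contributes. *)
Lemma integral_ground_density_ge (f : V -> R) (M : R) (x : V) :
  let q := 2 * N / (N - alpha) in
  measurable_fun setT f -> 0 < M ->
  (\int[mu]_(x in H) (`|f x| `^ q)%:E = M%:E)%E -> H x ->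
  ((8^-1 * N `^ (- (N + alpha)) * (2 * 2 `^ q) `^ (- (alpha / N)) *
    M `^ (- (alpha / N)) * `|f x| `^ q)%:E <=
    \int[mu]_(y in H) (ground_density alpha f (x, y))%:E)%E.
Proof.
move=> q mf M0 IM xH.
have [a1 a2] := (alpha_gt1, alpha_lt2).
have N2 : 2 <= N by rewrite ler_nat.
have N0 : 0 < N by lra.
have Na : 0 < N - alpha by lra.
have q0 : 0 < q by rewrite divr_gt0// mulr_gt0.
(* When f x = 0 the left side is 0; otherwise one may divide by |f x|. *)
have [fx0|/eqP/eqP fx0] := eqVneq (f x) 0.
  rewrite fx0 normr0 powR0 ?gt_eqF// mulr0 integral_ge0// => y _.
  by rewrite lee_fin ground_density_ge0.
set s := `|f x|; have s0 : 0 < s by rewrite normr_gt0.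
(* Twice the Chebyshev bound for the bad set; it becomes the volume of the cube. *)
pose K := 2 * 2 `^ q * M / s `^ q.
have K0 : 0 < K by rewrite divr_gt0 ?powR_gt0// !mulr_gt0// powR_gt0.
pose r := K `^ (N^-1).
have r0 : 0 < r by rewrite powR_gt0.
have rN : r ^+ n.+1 = K.
  by rewrite -powR_mulrn ?ltW// -powRrM mulVf ?gt_eqF// powRr1// ltW.
(* The cube [x, x + r]^N, since [cube] takes a centre and a half side. *)
pose Q := cube (\row_i (x 0 i + r / 2)) (r / 2).
have QP y : Q y -> forall i, x 0 i <= y 0 i <= x 0 i + r.
  by move=> Qy i; have := Qy i; rewrite mxE => /andP[? ?]; apply/andP; split; lra.
have xl0 : 0 < xlast x by [].
have QH : Q `<=` H.
  by move=> y /QP/(_ ord_max)/andP[h _]; exact: lt_le_trans h.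
have mQ : measurable Q by exact: measurable_cube.
have muQ : mu Q = K%:E.
  rewrite lebesgue_cube ?divr_ge0 ?(ltW r0)// -rN; congr ((_ ^+ _)%:E); lra.
have good := le_measure_good_part mQ mf QH s0 q0 IM.
set G := Q `&` _ in good.
have mnf : measurable_fun setT (fun y : V => `|f y|) by exact: measurableT_comp.
have mG : measurable G.
  apply: measurableI => //.
  rewrite (_ : [set y | _] = (fun y : V => `|f y|) @^-1` `]-oo, s / 2]%classic); last first.
    by apply/seteqP; split => y /=; rewrite in_itv.
  by rewrite -[X in measurable X]setTI; exact: mnf.
have muG : ((K / 2)%:E <= mu G)%E.
  move: good; rewrite muQ (_ : M * 2 `^ q / s `^ q = K / 2); last first.
    by rewrite /K; field; rewrite gt_eqF// powR_gt0.
  case: (mu G) => [g| |]; rewrite ?leey// -?EFinD ?lee_fin //; lra.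
(* A lower bound for the density on the good part: the weighted difference is at least w(x)^2 (s /
   (2 w(x)))^2 = s^2/4, and |x - y| <= N r. *)
pose c := (s ^+ 2 / 4) * ((N * r) `^ (N + alpha))^-1.
have c0 : 0 <= c by rewrite mulr_ge0 ?invr_ge0 ?powR_ge0// mulr_ge0 ?exprn_ge0// ltW.
apply: (@le_trans _ _ (c%:E * mu G)%E).
  apply: (@le_trans _ _ (c%:E * (K / 2)%:E)%E); last by rewrite lee_wpmul2l ?lee_fin.
  (* Here r^-(N+alpha) = K^-1 K^(-alpha/N), so the K of the volume cancels. The power of s in
     K^(-alpha/N) is q alpha / N = q - 2, which the factor s^2 completes to s^q. *)
  rewrite -EFinM lee_fin le_eqVlt; apply/orP; left; apply/eqP.
  rewrite /c -powRN (@powRM _ N r) ?(ltW N0) ?(ltW r0)//.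
  rewrite [r `^ _](_ : _ = K^-1 * K `^ (- (alpha / N))); last first.
    rewrite /r -powRrM -[K^-1]powR_inv1 ?(ltW K0)// -powRD; last first.
      by rewrite (gt_eqF K0) implybT.
    by congr powR; field; rewrite gt_eqF.
  have -> : K `^ (- (alpha / N)) = (2 * 2 `^ q) `^ (- (alpha / N)) *
      M `^ (- (alpha / N)) * s `^ (q - 2).
    rewrite /K powRM ?(ltW M0) ?mulr_ge0 ?invr_ge0 ?powR_ge0 ?(ltW M0)//.
    rewrite powRM ?(ltW M0) ?mulr_ge0 ?powR_ge0//; congr (_ * _).
    rewrite -powR_inv1 ?powR_ge0// -!powRrM; congr powR.
    by rewrite /q mulN1r opprK sobolev_exponent.
  have -> : s `^ q = s ^+ 2 * s `^ (q - 2).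
    rewrite -powR_mulrn ?(ltW s0)// -powRD; last by rewrite (gt_eqF s0) implybT.
    by congr powR; lra.
  have K0' := lt0r_neq0 K0.
  move: (N `^ (- (N + alpha))) ((2 * 2 `^ q) `^ _) (M `^ _) (s `^ (q - 2)) => u1 u2 u3 u4.
  by field.
rewrite -integral_cst//.
have mg : measurable_fun setT (fun y => (ground_density alpha f (x, y))%:E).
  apply/measurable_EFinP; apply: (measurableT_comp (measurable_ground_density alpha mf)).
  exact: measurable_fun_pair.
have g0 y : (0 <= (ground_density alpha f (x, y))%:E)%E by rewrite lee_fin ground_density_ge0.
apply: (@le_trans _ _ (\int[mu]_(y in G) (ground_density alpha f (x, y))%:E)%E); last first.
  apply: ge0_subset_integral => //; first exact: measurable_funTS.
  by move=> y [/QH].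
apply: ge0_le_integral => //; first exact: measurable_funTS.
move=> y [Qy /= fy]; rewrite lee_fin /c /ground_density/=.
have yH := QH _ Qy.
have wx0 : 0 < w x by exact: hardy_weight_gt0.
have wxy : w x <= w y.
  have /andP[xy _] := QP _ Qy ord_max.
  apply: ge0_ler_powR => //; rewrite ?nnegrE; [lra|exact: ltW|exact: ltW].
have wy0 : 0 < w y by exact: lt_le_trans wxy.
apply: ler_pM.
- by rewrite mulr_ge0 ?exprn_ge0// ltW.
- by rewrite invr_ge0 powR_ge0.
- have d : s / (2 * w x) <= `|f x / w x - f y / w y|.
    apply: le_trans (ler_dist_dist _ _).
    rewrite !normrM !normfV !(gtr0_norm wx0) !(gtr0_norm wy0) -/s.
    apply: le_trans (ler_norm _).
    have : `|f y| / w y <= s / 2 / w x.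
      by apply: ler_pM => //; rewrite ?invr_ge0 ?(ltW wy0)// lef_pV2.
    have -> : s / (2 * w x) = s / w x - s / 2 / w x by field; rewrite gt_eqF.
    by lra.
  have -> : s ^+ 2 / 4 = w x * w x * (s / (2 * w x)) ^+ 2 by field; rewrite gt_eqF.
  apply: ler_pM.
  + by rewrite mulr_ge0 ?ltW.
  + by rewrite exprn_ge0// divr_ge0 ?mulr_ge0// ltW.
  + by rewrite ler_pM2l.
  + by rewrite lerXn2r ?nnegrE// divr_ge0 ?mulr_ge0// ltW.
(* y = x is impossible on the good part, as |f x| = s > s/2. This matters because the kernel has the
   default value 0 on the diagonal. *)
- have [xy|xy] := eqVneq x y.
    move: fy; rewrite -xy -/s; lra.
  have e0 : 0 < enorm (x - y).
    rewrite lt_neqAle enorm_ge0 andbT eq_sym; apply/eqP => /enorm_eq0/eqP.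
    by rewrite subr_eq0 (negbTE xy).
  rewrite lef_pV2 ?posrE ?powR_gt0 ?mulr_gt0//.
  apply: ge0_ler_powR; rewrite ?nnegrE ?enorm_ge0 ?mulr_ge0 ?(ltW r0)//; first lra.
  apply: enorm_le; first exact: ltW.
  move=> i; have /andP[h1 h2] := QP _ Qy i.
  by rewrite !mxE ler_norml; apply/andP; split; lra.
Qed.

(** Integrating the pointwise bound in x turns M^(-alpha/N) into M^(1-alpha/N), and 1 - alpha/N =
    2/q. Dimension at least 2 ensures N > alpha. *)
Lemma ground_sobolev :
  let q := 2 * N / (N - alpha) in
  exists2 a : R, 0 < a & forall f : V -> R, measurable_fun setT f ->
    (\int[mu]_(x in H) (`|f x| `^ q)%:E < +oo)%E ->
    (a%:E * (\int[mu]_(x in H) (`|f x| `^ q)%:E) `^ (2 / q) <= ground_energy alpha f)%E.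
Proof.
move=> q.
have [a1 a2] := (alpha_gt1, alpha_lt2).
have N2 : 2 <= N by rewrite ler_nat.
have N0 : 0 < N by lra.
have Na : 0 < N - alpha by lra.
have q0 : 0 < q by rewrite divr_gt0// mulr_gt0.
pose c := 8^-1 * N `^ (- (N + alpha)) * (2 * 2 `^ q) `^ (- (alpha / N)).
have c0 : 0 < c by rewrite !mulr_gt0 ?powR_gt0// mulr_gt0// powR_gt0.
exists c => // f mf.
have I0 : (0 <= \int[mu]_(x in H) (`|f x| `^ q)%:E)%E.
  by apply: integral_ge0 => x _; rewrite lee_fin powR_ge0.
have mfq : measurable_fun setT (fun y : V => (`|f y| `^ q)%:E).
  apply/measurable_EFinP; apply: (measurableT_comp (measurable_powR _)).
  exact: measurableT_comp.
case IM : (\int[mu]_(x in H) (`|f x| `^ q)%:E)%E I0 => [M| |]//; rewrite lee_fin => M0 _.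
have G0 : (0 <= ground_energy alpha f)%E.
  by apply: integral_ge0 => p _; rewrite lee_fin ground_density_ge0.
(* M = 0 is separate, because the pointwise bound builds its cube from M > 0. *)
move: M0; rewrite le_eqVlt => /orP[/eqP M0|M0].
  by rewrite -M0 poweR0r ?mule0// gt_eqF// divr_gt0.
rewrite /ground_energy integral_halfspaceX; last 2 first.
- exact: measurable_ground_density.
- exact: ground_density_ge0.
have -> : (c%:E * M%:E `^ (2 / q) =
  \int[mu]_(x in H) ((c * M `^ (- (alpha / N)))%:E * (`|f x| `^ q)%:E))%E.
  rewrite ge0_integralZl//.
  - rewrite IM poweR_EFin -!EFinM -[in RHS]mulrA; congr (c * _)%:E.
    rewrite /q sobolev_exponentV// powRD; last by rewrite (gt_eqF M0) implybT.
    by rewrite powRr1// ltW.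
  - exact: measurable_funTS.
  - by rewrite lee_fin mulr_ge0 ?powR_ge0// ltW.
apply: ge0_le_integral => //.
- by move=> x _; rewrite -EFinM lee_fin !mulr_ge0 ?powR_ge0// ltW.
- apply: measurable_funTS; apply: emeasurable_funM => //.
- apply: measurable_funTS; apply: measurable_integral_halfspace.
    exact: measurable_ground_density.
  exact: ground_density_ge0.
- move=> x xH; rewrite -EFinM; exact: integral_ground_density_ge.
Qed.

End ground_sobolev.

(** * Finiteness for compactly supported functions *)

Section compact_support.
Variables (R : realType) (n : nat).
Local Notation V := 'rV[R]_n.+1.
Local Notation mu := (lebesgue_rV R n.+1).
Local Notation H := (@halfspace R n.+1).

Lemma ler_coord_mx_norm (x : V) i : `|x 0 i| <= `|x|.
Proof.
rewrite [leRHS]mx_normrE.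
exact: (le_bigmax _ (fun ij : 'I_1 * 'I_n.+1 => `|x ij.1 ij.2|) (0, i)).
Qed.

Lemma mx_norm_le (x : V) (r : R) : 0 <= r -> (forall i, `|x 0 i| <= r) -> `|x| <= r.
Proof.
move=> r0 xr; rewrite [leLHS]mx_normrE; apply/bigmax_leP; split=> // -[i j] _ /=.
by rewrite (ord1 i).
Qed.

(** A compact subset of the open halfspace is bounded and has positive distance from the boundary.
    These three constants are all that the finiteness statements below require. *)
Lemma Cc_halfspace_bounded (f : V -> R) : Cc_halfspace f ->
  exists M c r : R, [/\ 0 < M, 0 < c, 0 < r & forall x, f x != 0 ->
    [/\ `|f x| <= M, c <= xlast x & cube 0 r x]].
Proof.
move=> [cf csupp suppH].
have fsupp x : f x != 0 -> supp f x by move=> fx; exact: subset_closure.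
(* The extreme value theorem needs a nonempty support. *)
have [supp0|/set0P suppN0] := eqVneq (supp f) set0.
  exists 1, 1, 1; split => // x /fsupp; by rewrite supp0.
have [a _ amax] : exists2 c, supp f c & forall t, supp f t -> `|f t| <= `|f c|.
  have cnf : continuous (fun x => `|f x|).
    by move=> x; apply: continuous_comp; [exact: cf|exact: norm_continuous].
  have [c cs cmax] := EVT_max_rV suppN0 csupp (continuous_subspaceT cnf).
  by exists c => [|t ts]; [exact: set_mem|apply: cmax; exact: mem_set].
have [b bs bmin] : exists2 c, supp f c & forall t, supp f t -> xlast c <= xlast t.
  have cx : continuous (@xlast R n.+1) by move=> x; exact: coord_continuous.
  have [c cs cmax] := EVT_min_rV suppN0 csupp (continuous_subspaceT cx).
  by exists c => [|t ts]; [exact: set_mem|apply: cmax; exact: mem_set].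
have [r [_ /(_ (`|r| + 1))]] := compact_bounded csupp.
rewrite (le_lt_trans (ler_norm r)) ?ltrDl// => /(_ isT) rb.
exists (`|f a| + 1), (xlast b), (`|r| + 1); split.
- by rewrite ltr_wpDl.
- exact: suppH.
- by rewrite ltr_wpDl.
move=> x /fsupp xs; split.
- by rewrite (le_trans (amax _ xs))// lerDl.
- exact: bmin.
- move=> i; rewrite mxE sub0r add0r -ler_norml.
  exact: le_trans (ler_coord_mx_norm x i) (rb _ xs).
Qed.

Lemma integral_cube_bounded (g : V -> R) (C r : R) :
  measurable_fun setT g -> 0 <= r -> 0 <= C -> (forall x, 0 <= g x) ->
  (forall x, H x -> g x <= C * \1_(cube 0 r) x) ->
  (\int[mu]_(x in H) (g x)%:E < +oo)%E.
Proof.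
move=> mg r0 C0 g0 gC.
have mcube : measurable_fun setT (\1_(cube 0 r) : V -> R).
  by apply: measurable_indic; exact: measurable_cube.
have mC : measurable_fun setT (fun x : V => (C * \1_(cube 0 r) x)%:E).
  by apply/measurable_EFinP; exact: measurable_funM.
have mH := @measurable_halfspace R n.
apply: (@le_lt_trans _ _ (\int[mu]_x (C * \1_(cube 0 r) x)%:E)%E).
  apply: (@le_trans _ _ (\int[mu]_(x in H) (C * \1_(cube 0 r) x)%:E)%E).
    apply: ge0_le_integral => //.
    - by move=> x _; rewrite lee_fin.
    - by apply: measurable_funTS; exact/measurable_EFinP.
    - exact: measurable_funTS.
  apply: ge0_subset_integral => //.
  by move=> x _; rewrite lee_fin mulr_ge0.
under eq_integral do rewrite EFinM.
rewrite ge0_integralZl//; last exact/measurable_EFinP.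
by rewrite integral_indic_cube// -EFinM ltry.
Qed.

Lemma Cc_halfspace_measurable (f : V -> R) : Cc_halfspace f -> measurable_fun setT f.
Proof. by case=> cf _ _; exact: continuous_measurable_rV. Qed.

Lemma Cc_hardy_integral_lty (alpha : R) (f : V -> R) : 0 < alpha -> Cc_halfspace f ->
  (hardy_integral alpha f < +oo)%E.
Proof.
move=> a0 ccf; have [M [c [r [M0 c0 r0 fb]]]] := Cc_halfspace_bounded ccf.
apply: (@integral_cube_bounded _ (M ^+ 2 / c `^ alpha) r).
- by apply: measurable_hardy_integrand; exact: Cc_halfspace_measurable.
- exact: ltW.
- by rewrite divr_ge0 ?powR_ge0// exprn_ge0// ltW.
- exact: hardy_integrand_ge0.
- move=> x xH; have [->|fx] := eqVneq (f x) 0.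
    by rewrite normr0 expr2 !mul0r mulr_ge0// divr_ge0 ?powR_ge0// exprn_ge0// ltW.
  have [fM cx xr] := fb _ fx; rewrite indicE mem_set// mulr1.
  have xl0 : 0 < xlast x by [].
  apply: ler_pM.
  + exact: exprn_ge0.
  + by rewrite invr_ge0 powR_ge0.
  + by rewrite lerXn2r ?nnegrE// ltW.
  + rewrite lef_pV2 ?posrE ?powR_gt0//.
    by apply: ge0_ler_powR => //; rewrite ?nnegrE; exact: ltW.
Qed.

Lemma Cc_integral_powR_lty (q : R) (f : V -> R) : 0 < q -> Cc_halfspace f ->
  (\int[mu]_(x in H) (`|f x| `^ q)%:E < +oo)%E.
Proof.
move=> q0 ccf; have [M [c [r [M0 c0 r0 fb]]]] := Cc_halfspace_bounded ccf.
apply: (@integral_cube_bounded _ (M `^ q) r).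
- apply: (measurableT_comp (measurable_powR _)); apply: measurableT_comp => //.
  exact: Cc_halfspace_measurable.
- exact: ltW.
- exact: powR_ge0.
- by move=> x; exact: powR_ge0.
- move=> x xH; have [->|fx] := eqVneq (f x) 0.
    by rewrite normr0 powR0 ?gt_eqF// mulr_ge0// powR_ge0.
  have [fM cx xr] := fb _ fx; rewrite indicE mem_set// mulr1.
  by apply: ge0_ler_powR => //; rewrite ?nnegrE; exact: ltW.
Qed.

End compact_support.

(** * Sharpness: logarithmic cutoffs *)

Section hyperbolic_box.
Variables (R : realType) (n : nat).
Local Notation V := 'rV[R]_n.+1.
Local Notation mu := (lebesgue_rV R n.+1).
Local Notation H := (@halfspace R n.+1).

Definition hbox_side (t r : R) (i : 'I_n.+1) : set (measurableTypeR R) :=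
  if i == ord_max then `[expR (- t), expR t]%classic else `[- r, r]%classic.

Definition hbox (t r : R) : set V := [set x | forall i, hbox_side t r i (x 0 i)].

Lemma measurable_hbox t r : measurable (hbox t r).
Proof.
apply: (@measurable_rV_box _ _ (hbox_side t r)) => i; rewrite /hbox_side.
by case: ifP => _; exact: measurable_itv.
Qed.

Lemma compact_hbox t r : compact (hbox t r).
Proof.
apply: (@rV_compact _ _ (hbox_side t r)) => i; rewrite /hbox_side.
by case: ifP => _; exact: segment_compact.
Qed.

Lemma hbox_xlast t r x : hbox t r x -> expR (- t) <= xlast x <= expR t.
Proof. by move=> /(_ ord_max); rewrite /hbox_side eqxx /= in_itv. Qed.

Lemma hbox_halfspace t r : hbox t r `<=` H.
Proof. by move=> x /hbox_xlast/andP[h _]; exact: (lt_le_trans (expR_gt0 _) h). Qed.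

Lemma integral_itv_inv (t : R) : 0 < t ->
  (\int[lebesgue_measure]_a
     (\1_(`[expR (- t), expR t]%classic : set R) a * a `^ (-1))%:E = (2 * t)%:E)%E.
Proof.
move=> t0.
have e0 : 0 < expR (- t) by exact: expR_gt0.
have et : expR (- t) < expR t by rewrite ltr_expR; lra.
transitivity (\int[lebesgue_measure]_(a in `[expR (- t), expR t]) (a^-1)%:E)%E.
  rewrite [RHS]integral_mkcond; apply: eq_integral => a _; rewrite patchE indicE.
  case: ifPn => [/set_mem/=|]; last by rewrite mul0r.
  by rewrite in_itv/= mul1r => /andP[ea _]; rewrite powR_inv1// ltW// (lt_le_trans e0).
rewrite (@continuous_FTC2 _ (fun a : R => a^-1) (@ln R))//.
- by rewrite !expRK -EFinB; congr EFin; lra.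
- apply: continuous_in_subspaceT => a; rewrite inE/= in_itv/= => /andP[ea _].
  by apply: inv_continuous; rewrite gt_eqF// (lt_le_trans e0).
- split.
  + move=> a; rewrite in_itv/= => /andP[ea _].
    by apply: ex_derive; apply: is_derive1_ln; exact: lt_trans ea.
  + by apply: cvg_at_right_filter; exact: continuous_ln.
  + by apply: cvg_at_left_filter; apply: continuous_ln; exact: expR_gt0.
- move=> a; rewrite in_itv/= => /andP[ea _].
  rewrite derive1E; have a0 := lt_trans e0 ea.
  by have [_ ->] := is_derive1_ln a0.
Qed.

(** The measure dx/x_n is w^2 x_n^-alpha dx. Its vertical factor over [e^-t, e^t] is 2t, linear in
    the logarithmic height, so doubling t and r costs only a fixed factor. *)
Lemma integral_hbox t r : 0 < t -> 0 <= r ->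
  (\int[mu]_(x in H) (\1_(hbox t r) x * xlast x `^ (-1))%:E =
   ((2 * r) ^+ n * (2 * t))%:E)%E.
Proof.
move=> t0 r0.
pose h (i : 'I_n.+1) (a : measurableTypeR R) : R := if i == ord_max then a `^ (-1) else 1.
pose g i a : R := \1_(hbox_side t r i) a * h i a.
have hE x : \1_(hbox t r) x * xlast x `^ (-1) = \prod_(i < n.+1) g i (x 0 i).
  rewrite big_split/=; congr (_ * _); last first.
    rewrite (bigD1 ord_max)//= big1 ?mulr1 /h ?eqxx// => i.
    by move=> /negbTE ->.
  rewrite indicE; case: (boolP (x \in _)) => [/set_mem xB|/negP xB].
    by rewrite big1// => i _; rewrite indicE mem_set.
  have [i iB] : exists i, ~ hbox_side t r i (x 0 i).
    by apply/existsNP => xB'; apply: xB; apply/mem_set.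
  by rewrite (bigD1 i)//= indicE memNset// mul0r.
transitivity (\int[mu]_x (\prod_(i < n.+1) g i (x 0 i))%:E)%E.
  rewrite integral_mkcond; apply: eq_integral => x _; rewrite patchE.
  case: ifPn => [_|/negP xH]; first by rewrite hE.
  rewrite -hE indicE memNset ?mul0r// => /hbox_halfspace xB.
  by apply: xH; apply/mem_set.
rewrite integral_rV_prod.
- rewrite big_ord_recr/= EFinM; congr (_ * _)%E; last first.
    rewrite -(integral_itv_inv t0); apply: eq_integral => a _.
    by rewrite /g /h /hbox_side eqxx.
  rewrite (_ : ((2 * r) ^+ n)%:E = \prod_(i < n) (2 * r)%:E)%E; last first.
    by rewrite prodEFin prodr_const card_ord.
  apply: eq_bigr => i _.
  transitivity (\int[lebesgue_measure]_a (\1_(`[- r, r]%classic : set R) a)%:E)%E.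
    apply: eq_integral => a _; rewrite /g /h /hbox_side.
    have -> : (widen_ord (leqnSn n) i == ord_max) = false.
      by apply/negbTE; rewrite -val_eqE/= neq_ltn ltn_ord.
    by rewrite mulr1.
  rewrite integral_indic// setIT.
  transitivity (lebesgue_measure `[- r, r]%classic); first by [].
  rewrite lebesgue_measure_itv/= lte_fin.
  case: ifPn => [_|]; first by rewrite -EFinB; congr EFin; lra.
  by rewrite -leNgt => h0; congr EFin; lra.
- move=> i; apply: measurable_funM.
    apply: measurable_indic; rewrite /hbox_side.
    by case: ifP => _; exact: measurable_itv.
  by rewrite /h; case: (i == ord_max) => //; exact: measurable_powR.
- by move=> i a; rewrite /g /h mulr_ge0//; case: ifP => // _; exact: powR_ge0.
Qed.

End hyperbolic_box.

(** * The cutoff profile and elementary Lipschitz bounds *)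

Section plateau.
Variable R : realType.
Implicit Types s t a b c d : R.

Definition plateau t : R := Num.max 0 (Num.min 1 (2 - t)).

Lemma plateau_eq1 t : t <= 1 -> plateau t = 1.
Proof.
by move=> t1; rewrite /plateau (min_idPl _) ?(max_idPr _)//; lra.
Qed.

Lemma plateau_neq0 t : plateau t != 0 -> t < 2.
Proof.
rewrite ltNge; apply: contra => t2; apply/eqP.
by rewrite /plateau (min_idPr _) ?(max_idPl _)//; lra.
Qed.

Lemma plateau_eq0 (t : R) : 2 <= t -> plateau t = 0.
Proof.
by move=> t2; apply/eqP; apply: contraTT t2 => /plateau_neq0; rewrite ltNge.
Qed.

Lemma plateau_cases t : [\/ t <= 1 /\ plateau t = 1,
  1 <= t <= 2 /\ plateau t = 2 - t | 2 <= t /\ plateau t = 0].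
Proof.
have [t1|t1] := leP t 1; first by constructor 1; rewrite plateau_eq1.
have m : Num.min 1 (2 - t) = 2 - t by apply/min_idPr; lra.
rewrite /plateau m; have [t2|t2] := leP t 2.
  by constructor 2; rewrite (ltW t1) (max_idPr _)//; lra.
by constructor 3; rewrite (ltW t2) (max_idPl _)//; lra.
Qed.

Lemma plateau_dist s t : `|plateau s - plateau t| <= Num.min 1 `|s - t|.
Proof.
have h := ler_norm (s - t); have h' := ler_norm (t - s); rewrite distrC in h'.
rewrite le_min !ler_norml.
by case: (plateau_cases s) => -[hs ->]; case: (plateau_cases t) => -[ht ->];
  do ![apply/andP; split]; lra.
Qed.

Lemma max_dist a b c d :
  `|Num.max a b - Num.max c d| <= Num.max `|a - c| `|b - d|.
Proof.
rewrite le_max ler_norml [in X in _ || X]ler_norml.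
have h1 := ler_norm (a - c); have h2 := ler_norm (c - a); rewrite distrC in h2.
have h3 := ler_norm (b - d); have h4 := ler_norm (d - b); rewrite distrC in h4.
by case: (leP a b) => ?; case: (leP c d) => ?; apply/orP;
  first [right; apply/andP; split; lra | left; apply/andP; split; lra |
   case: (leP `|a - c| `|b - d|) => ?; [right|left]; apply/andP; split; lra].
Qed.

(** From ln u <= u - 1 and -ln u = ln(1/u) <= 1/u - 1; the factor 2 bounds 1/u. *)
Lemma ln_le_dist (u : R) : 2^-1 <= u -> `|ln u| <= 2 * `|u - 1|.
Proof.
move=> u2; have u0 : 0 < u by lra.
have h1 : ln u <= u - 1 by rewrite -{1}(subrKC 1 u); apply: le_ln1Dx; lra.
have h2 : - ln u <= u^-1 - 1.
  by rewrite -lnV// -{1}(subrKC 1 u^-1); apply: le_ln1Dx; rewrite ltrBrDr addNr invr_gt0.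
have h3 : u^-1 - 1 <= 2 * `|u - 1|.
  have -> : u^-1 - 1 = u^-1 * (1 - u) by field; rewrite gt_eqF.
  have ui : u^-1 <= 2 by rewrite -[leRHS]invrK lef_pV2 ?posrE ?invr_gt0.
  rewrite distrC; apply: (@le_trans _ _ (u^-1 * `|1 - u|)).
    by rewrite ler_pM2l ?invr_gt0// ler_norm.
  by rewrite ler_wpM2r.
have := ler_norm (u - 1); have := normr_ge0 (u - 1).
by rewrite ler_norml => ? ?; apply/andP; split; lra.
Qed.

End plateau.

(** * A scale-invariant distance controlling the cutoffs *)

Section proximity.
Variables (R : realType) (n : nat).
Local Notation V := 'rV[R]_n.+1.
Local Notation mu := (lebesgue_rV R n.+1).
Local Notation H := (@halfspace R n.+1).
Local Notation e := (@erow R n).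

Definition hproj (x : V) : V := x - xlast x *: e.

Lemma hprojE x i : hproj x 0 i = if i == ord_max then 0 else x 0 i.
Proof.
rewrite /hproj !mxE eqxx/= eq_sym; case: eqP => [->|_].
  by rewrite mulr1 subrr.
by rewrite mulr0 subr0.
Qed.

Lemma hproj_erow : hproj e = 0.
Proof. by rewrite /hproj xlast_erow scale1r subrr. Qed.

Lemma hproj_half_affine x z : hproj (half_affine x z) = xlast x *: hproj z + hproj x.
Proof.
rewrite /hproj xlast_half_affine /half_affine.
by apply/rowP => i; rewrite !mxE; ring.
Qed.

(** A substitute for hyperbolic distance. Horizontal displacement is measured in units of the height
    of the first point, which makes it invariant under [half_affine] but not symmetric. *)
Definition hdist (p : V * V) : R :=
  Num.max `|ln (xlast p.1) - ln (xlast p.2)| (`|hproj p.1 - hproj p.2| / `|xlast p.1|).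

(** A majorant for the squared difference of a cutoff of logarithmic width k+1; being scale
    invariant, it can replace the truncation in [integral_scale_invariant_weight]. *)
Definition prox (k : nat) (p : V * V) : R := Num.min 1 ((hdist p / k.+1%:R) ^+ 2).

Lemma hdist_ge0 p : 0 <= hdist p.
Proof. by rewrite le_max normr_ge0. Qed.

Lemma prox_ge0 k p : 0 <= prox k p.
Proof. by rewrite le_min ler01 sqr_ge0. Qed.

Lemma measurable_mx_norm : measurable_fun [set: V] (fun x => `|x|).
Proof. by apply: continuous_measurable_rV => x; exact: norm_continuous. Qed.

Lemma measurable_hproj : measurable_fun setT hproj.
Proof.
apply: measurable_rVB => //; apply: measurable_rVZ => //.
exact: measurable_xlast.
Qed.

Lemma measurable_prox k : measurable_fun setT (prox k).
Proof.
have ml : measurable_fun setT (fun x : V => ln (xlast x)).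
  exact: (measurableT_comp (@measurable_ln R) (@measurable_xlast R n)).
apply: measurable_minr => //; apply: measurable_funX; apply: measurable_funM => //.
apply: measurable_maxr.
  apply: measurableT_comp => //; apply: measurable_funB.
    exact: (measurable_comp_fst ml).
  exact: (measurable_comp_snd ml).
apply: measurable_funM.
  apply: (measurableT_comp measurable_mx_norm); apply: measurable_rVB.
    exact: (measurableT_comp measurable_hproj).
  exact: (measurableT_comp measurable_hproj).
apply: measurable_inv_ge0 => //; apply: measurableT_comp => //.
exact: (measurable_comp_fst (@measurable_xlast R n)).
Qed.

Lemma scale_invariant_prox k : scale_invariant (prox k).
Proof.
move=> x z x0 z0; rewrite /prox; suff -> : hdist (x, half_affine x z) = hdist (e, z) by [].
have xl0 : 0 < xlast x by [].
have zl0 : 0 < xlast z by [].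
rewrite /hdist ![(_, _).1]/= ![(_, _).2]/= xlast_half_affine hproj_half_affine.
rewrite xlast_erow hproj_erow ln1 normr1 invr1 mulr1 lnM ?posrE//.
rewrite opprD addrA subrr; congr Num.max.
rewrite opprD addrCA subrr addr0 sub0r !normrN normrZ.
by rewrite mulrC mulrA mulVf ?mul1r// normr_eq0 gt_eqF.
Qed.

(** The bound is uniform in k, so that dominated convergence applies. Far from e the minimum is at
    least 1/4. Near e the logarithm contributes at most 2s and the horizontal part at most s, hence
    (2s)^2. *)
Lemma prox_bound k z : H z -> prox k (e, z) <= 4 * Num.min 1 (enorm (z - e) ^+ 2).
Proof.
move=> z0; have zl0 : 0 < xlast z by [].
have s0 := enorm_ge0 (z - e).
rewrite /prox; set s := enorm (z - e) in s0 *.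
have [s1|s1] := leP (2^-1) s.
  have h : 4^-1 <= Num.min 1 (s ^+ 2).
    by rewrite le_min; apply/andP; split; [lra|rewrite expr2; nra].
  apply: (@le_trans _ _ 1); first by rewrite ge_min lexx.
  by move: (Num.min _ _) h => M h; lra.
have zl := ler_coord_enorm (z - e) ord_max.
rewrite !mxE !eqxx/= -/s in zl.
have zs : `|xlast z - 1| <= s by [].
have zl2 : 2^-1 <= xlast z by move: zs; rewrite ler_norml => /andP[]; lra.
have -> : Num.min 1 (s ^+ 2) = s ^+ 2 by apply/min_idPr; rewrite expr2; nra.
rewrite ge_min; apply/orP; right.
have hd : hdist (e, z) <= 2 * s.
  rewrite /hdist ![(_, _).1]/= ![(_, _).2]/= xlast_erow hproj_erow ln1 normr1 invr1 mulr1.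
  rewrite !sub0r !normrN ge_max; apply/andP; split.
    by apply: le_trans (ln_le_dist zl2) _; rewrite ler_pM2l.
  apply: (@le_trans _ _ s); last by lra.
  apply: mx_norm_le => // i; rewrite hprojE; case: ifPn => [_|ie]; first by rewrite normr0.
  have := ler_coord_enorm (z - e) i; rewrite !mxE (negbTE ie) andbF subr0.
  exact.
have hk : hdist (e, z) / k.+1%:R <= 2 * s.
  rewrite ler_pdivrMr//; apply: (le_trans hd).
  by rewrite ler_peMr ?mulr_ge0// ler1n.
have -> : 4 * s ^+ 2 = (2 * s) ^+ 2 by ring.
by rewrite lerXn2r ?nnegrE ?mulr_ge0 ?divr_ge0 ?hdist_ge0.
Qed.

Lemma prox_cvg0 p : prox k p @[k --> \oo] --> (0 : R).
Proof.
apply: (@squeeze_cvgr _ _ _ _ (cst 0) (fun k => hdist p ^+ 2 * k.+1%:R^-1)).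
- apply: nearW => k /=; rewrite prox_ge0/= /prox ge_min; apply/orP; right.
  rewrite expr_div_n ler_wpM2l ?sqr_ge0// lef_pV2 ?posrE ?exprn_gt0//.
  by rewrite -[leLHS]mulr1 expr2 ler_pM2l// ler1n.
- exact: cvg_cst.
- rewrite -[X in _ --> X](mulr0 (hdist p ^+ 2)); apply: cvgMr.
  exact: cvg_harmonic.
Qed.

Variable alpha : R.
Hypotheses (alpha_gt1 : 1 < alpha) (alpha_lt2 : alpha < 2).
Local Notation w := (@hardy_weight R n alpha).
Local Notation ker := (@riesz_kernel R n alpha).

Lemma integral_prox_cvg0 :
  (\int[mu]_(z in H) (w z * (prox k (e, z) * ker e z))%:E @[k --> \oo] --> 0)%E.
Proof.
have mH := @measurable_halfspace R n.
have mw := @measurable_hardy_weight R n alpha.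
have mk : measurable_fun setT (fun z : V => ker e z) by exact: measurable_riesz_kernel.
have mp k : measurable_fun setT (fun z : V => w z * (prox k (e, z) * ker e z)).
  apply: measurable_funM => //; apply: measurable_funM => //.
  by apply: (measurableT_comp (measurable_prox k)); exact: measurable_fun_pair.
have mK := @measurable_near_kernel R n alpha.
rewrite [X in _ --> X](_ : _ = \int[mu]_(z in H) (cst 0%E z))%E; last by rewrite integral0.
apply: (@dominated_cvg _ _ _ _ _ mH _ _ (fun z => (4 * near_kernel alpha z)%:E)).
- by move=> k; apply: measurable_funTS; apply/measurable_EFinP; exact: mp.
- move=> z zH /=; apply: cvg_EFin; first by exact: nearW.
  have h : w z * (prox k (e, z) * ker e z) @[k --> \oo] --> w z * (0 * ker e z).
    by apply: cvgMr; apply: cvgMl; exact: prox_cvg0.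
  by rewrite mul0r mulr0 in h; exact: h.
- by [].
- apply/integrableP; split.
    apply: measurable_funTS; apply/measurable_EFinP.
    by apply: measurable_funM; [exact: measurable_cst|exact: mK].
  rewrite (eq_integral (fun z => 4%:E * (near_kernel alpha z)%:E)%E); last first.
    move=> z _; rewrite EFinM gee0_abs// -EFinM lee_fin mulr_ge0//.
    exact: near_kernel_ge0.
  rewrite ge0_integralZl//.
  + by rewrite lte_mul_pinfty// integral_near_kernel_lty.
  + by apply: measurable_funTS; apply/measurable_EFinP; exact: mK.
  + by move=> z _; rewrite lee_fin near_kernel_ge0.
- move=> k z zH; rewrite abse_EFin lee_fin ger0_norm; last first.
    by rewrite !mulr_ge0 ?prox_ge0 ?hardy_weight_ge0 ?riesz_kernel_ge0.
  rewrite (riesz_kernelC _ e z).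
  apply: (@le_trans _ _ (w z * (4 * Num.min 1 (enorm (z - e) ^+ 2) * ker z e))).
    by rewrite ler_wpM2l ?hardy_weight_ge0// ler_wpM2r ?riesz_kernel_ge0// prox_bound.
  have : 0 <= Num.min 1 (enorm (z - e) ^+ 2) * ker z e.
    by rewrite mulr_ge0 ?riesz_kernel_ge0// le_min ler01 sqr_ge0.
  rewrite /near_kernel; move: (Num.min _ _) (ker z e) (w z) => m kk a mk0.
  rewrite -subr_ge0 (_ : _ - _ = 4 * (m * kk)); last by ring.
  by rewrite mulr_ge0.
Qed.

End proximity.

(** * The test functions *)

Section sharpness.
Variables (R : realType) (n : nat) (alpha : R).
Hypotheses (alpha_gt1 : 1 < alpha) (alpha_lt2 : alpha < 2).
Local Notation V := 'rV[R]_n.+1.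
Local Notation mu := (lebesgue_rV R n.+1).
Local Notation H := (@halfspace R n.+1).
Local Notation e := (@erow R n).
Local Notation w := (@hardy_weight R n alpha).
Local Notation ker := (@riesz_kernel R n alpha).

Let mH : measurable H := @measurable_halfspace R n.

Section test_function.
Variable k : nat.
Local Notation K := (k.+1%:R : R).
Local Notation L := (k.+1%:R * expR (2 * k.+1%:R) : R).

(** The horizontal scale L is K e^(2K) because heights up to e^(2K) occur in the support: a
    horizontal displacement divided by L is then at most its size in units of the height, divided by
    K. *)
Definition cutoff (x : V) : R :=
  plateau (Num.max (`|ln (xlast x)| / K) (`|hproj x| / L)).

(** The level lies below the height e^(-2K) at which the cutoff already vanishes. *)
Definition clamp (x : V) : R := Num.max (xlast x) (expR (- (3 * K))).

(* Equals w * cutoff on the halfspace; clamping x_n from below makes it continuous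
   on the whole space without changing it there. *)
Definition test_fun (x : V) : R :=
  expR ((alpha - 1) / 2 * ln (clamp x)) *
  plateau (Num.max (`|ln (clamp x)| / K) (`|hproj x| / L)).

Let K0 : 0 < K. Proof. by []. Qed.
Let L0 : 0 < L. Proof. by rewrite mulr_gt0 ?expR_gt0. Qed.

Lemma test_funE x : H x -> test_fun x = w x * cutoff x.
Proof.
move=> x0; have xl0 : 0 < xlast x by [].
rewrite /test_fun /clamp /cutoff.
have [h|h] := leP (expR (- (3 * K))) (xlast x).
  by rewrite /hardy_weight /powR gt_eqF.
(* Below the clamping level both plateaus vanish: the clamped logarithm has size 3K and the true one
   is larger. *)
rewrite expRK !plateau_eq0 ?mulr0//.
  rewrite le_max; apply/orP; left; rewrite ler_pdivlMr//.
  have : ln (xlast x) < - (3 * K) by rewrite -(expRK (- (3 * K))) ltr_ln ?posrE ?expR_gt0.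
  have := ler_norm (- ln (xlast x)); have := K0; rewrite normrN; lra.
rewrite le_max; apply/orP; left; rewrite normrN normrM !ger0_norm// mulfK//; lra.
Qed.

(** This includes points outside the halfspace: wherever the clamp is active, the plateau is
    evaluated at 3 or more and vanishes. *)
Lemma test_fun_support x : test_fun x != 0 -> hbox (2 * K) (2 * L) x.
Proof.
rewrite mulf_eq0 negb_or => /andP[_ /plateau_neq0].
rewrite gt_max => /andP[]; rewrite !ltr_pdivrMr// => lnx hx.
have cx : clamp x = xlast x.
  rewrite /clamp; apply/max_idPl; rewrite leNgt; apply/negP => h.
  move: lnx; rewrite /clamp (max_idPr (ltW h)) expRK normrN ger0_norm ?mulr_ge0//.
  by rewrite ltr_pM2r//; lra.
have xl0 : 0 < xlast x.
  by rewrite -cx /clamp lt_max expR_gt0 orbT.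
move: lnx; rewrite cx ltr_norml => /andP[l1 l2] i; rewrite /hbox_side.
case: ifPn => [/eqP ->|ie] /=; rewrite in_itv/=.
  have xE : x 0 ord_max = expR (ln (xlast x)) by rewrite lnK// posrE.
  by rewrite xE !ler_expR; apply/andP; split; lra.
rewrite -ler_norml; apply: le_trans (ltW hx).
by have := ler_coord_mx_norm (hproj x) i; rewrite hprojE (negbTE ie).
Qed.

Lemma cutoff_eq1 x : hbox K L x -> cutoff x = 1.
Proof.
move=> xB; have /andP[x1 x2] := hbox_xlast xB.
have xl0 : 0 < xlast x by exact: hbox_halfspace xB.
apply: plateau_eq1; rewrite ge_max; apply/andP; split; rewrite ler_pdivrMr// mul1r.
  rewrite ler_norml -{1}(expRK (- K)) -{2}(expRK K).
  by rewrite !ler_ln ?posrE ?expR_gt0// x1 x2.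
apply: mx_norm_le => [|i]; first exact: ltW.
rewrite hprojE; case: ifPn => [_|ie]; first by rewrite normr0 ltW.
by have := xB i; rewrite /hbox_side (negbTE ie) /= in_itv/= ler_norml.
Qed.

Lemma continuous_test_fun : continuous test_fun.
Proof.
have cl : continuous (@xlast R n.+1 : V -> R) by move=> x; exact: coord_continuous.
have hc : continuous (@hproj R n).
  move=> x; apply: (@continuousB _ _ _ (fun x : V => x) (fun x : V => xlast x *: e)).
    exact: cvg_id.
  exact: (@cvgZr_tmp _ _ _ (nbhs x) _ (@xlast R n.+1) (xlast x) e (cl x)).
have ch : continuous (fun x : V => `|hproj x|).
  move=> x; apply: (@continuous_comp _ _ _ (@hproj R n) (fun y : V => `|y|)).
    exact: hc.
  exact: norm_continuous.
have cc : continuous clamp.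
  by move=> x; apply: (@continuous_max _ _ (@xlast R n.+1) (cst _));
    [exact: cl|exact: cst_continuous].
have clc : continuous (fun x => ln (clamp x)).
  move=> x; apply: (@continuous_comp _ _ _ clamp (@ln R)); first exact: cc.
  by apply: continuous_ln; rewrite /clamp lt_max expR_gt0 orbT.
have clcn : continuous (fun x => `|ln (clamp x)|).
  move=> x; apply: (@continuous_comp _ _ _ (fun x => ln (clamp x)) (fun y : R => `|y|)).
    exact: clc.
  exact: norm_continuous.
have cm : continuous (fun x : V => Num.max (`|ln (clamp x)| / K) (`|hproj x| / L)).
  move=> x; apply: (@continuous_max _ _
    (fun x => `|ln (clamp x)| / K) (fun x => `|hproj x| / L)).
    by apply: (@continuousM _ _ _ (cst _)); [exact: clcn|exact: cst_continuous].
  by apply: (@continuousM _ _ _ (cst _)); [exact: ch|exact: cst_continuous].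
have ce : continuous (fun x => expR ((alpha - 1) / 2 * ln (clamp x))).
  move=> x; apply: (@continuous_comp _ _ _ (fun x => (alpha - 1) / 2 * ln (clamp x)) expR).
    by apply: (@continuousM _ _ (cst _)); [exact: cst_continuous|exact: clc].
  exact: continuous_expR.
move=> x; apply: (@continuousM _ _ (fun x => expR ((alpha - 1) / 2 * ln (clamp x)))).
  exact: ce.
apply: (@continuous_comp _ _ _
    (fun x : V => Num.max (`|ln (clamp x)| / K) (`|hproj x| / L)) (@plateau R)).
  exact: cm.
apply: (@continuous_max _ _ (cst 0) (fun t : R => Num.min 1 (2 - t))).
  exact: cst_continuous.
apply: (@continuous_min _ _ (cst 1) (fun t : R => 2 - t)).
  exact: cst_continuous.
apply: (@continuousB _ R^o _ (cst 2) id); [exact: cst_continuous|exact: cvg_id].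
Qed.

Lemma Cc_test_fun : Cc_halfspace test_fun.
Proof.
have cB := @compact_hbox R n (2 * K) (2 * L).
have sB : supp test_fun `<=` hbox (2 * K) (2 * L).
  have clB : closed (@hbox R n (2 * K) (2 * L)).
    by apply: compact_closed => //; exact: norm_hausdorff.
  rewrite closure_id in clB; rewrite clB; apply: closure_subset.
  by move=> x; exact: test_fun_support.
split.
- exact: continuous_test_fun.
- by apply: (subclosed_compact _ cB sB); exact: closed_closure.
- by move=> x /sB; exact: hbox_halfspace.
Qed.

End test_function.
End sharpness.

(** * Energy against Hardy integral for the test functions *)

Section sharpness_estimate.
Variables (R : realType) (n : nat) (alpha : R).
Hypotheses (alpha_gt1 : 1 < alpha) (alpha_lt2 : alpha < 2).
Local Notation V := 'rV[R]_n.+1.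
Local Notation mu := (lebesgue_rV R n.+1).
Local Notation H := (@halfspace R n.+1).
Local Notation e := (@erow R n).
Local Notation w := (@hardy_weight R n alpha).
Local Notation ker := (@riesz_kernel R n alpha).

Let mH : measurable H := @measurable_halfspace R n.
Let mHH : measurable (H `*` H) := measurableX mH mH.

(** A comparison function with an explicit Hardy integral: the box K, L bounds the Hardy integral of
    the test function from below, and the box 2K, 2L bounds its ground energy from above. *)
Definition box_weight (t r : R) (x : V) : R := w x * \1_(hbox t r) x.

Lemma measurable_box_weight t r : measurable_fun setT (box_weight t r).
Proof.
apply: measurable_funM; first exact: measurable_hardy_weight.
by apply: measurable_indic; exact: measurable_hbox.
Qed.

Lemma hardy_weight_sqr x : H x -> w x ^+ 2 / xlast x `^ alpha = xlast x `^ (-1).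
Proof.
move=> x0; have xl0 : 0 < xlast x by [].
rewrite -powRN /hardy_weight -powR_mulrn ?powR_ge0// -powRrM -powRD; last first.
  by rewrite (gt_eqF xl0) implybT.
by congr powR; lra.
Qed.

Lemma hardy_integral_box_weight t r : 0 < t -> 0 <= r ->
  hardy_integral alpha (box_weight t r) = ((2 * r) ^+ n * (2 * t))%:E.
Proof.
move=> t0 r0; rewrite -integral_hbox//; apply: eq_integral => x /set_mem x0.
rewrite /box_weight indicE; case: (boolP (x \in _)) => _.
  by rewrite mulr1 mul1r real_normK ?num_real// hardy_weight_sqr.
by rewrite mulr0 normr0 expr2 !mul0r.
Qed.

Section test_function.
Variable k : nat.
Local Notation K := (k.+1%:R : R).
Local Notation L := (k.+1%:R * expR (2 * k.+1%:R) : R).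

Let K0 : 0 < K. Proof. by []. Qed.
Let L0 : 0 < L. Proof. by rewrite mulr_gt0 ?expR_gt0. Qed.

(** Only the height of x is bounded, since [hdist] takes its unit of length from the first point. *)
Lemma cutoff_dist x y : H x -> H y -> xlast x <= expR (2 * K) ->
  `|cutoff k x - cutoff k y| ^+ 2 <= prox k (x, y).
Proof.
move=> x0 y0 xK; have xl0 : 0 < xlast x by [].
have d0 := hdist_ge0 (x, y).
have d : `|cutoff k x - cutoff k y| <= Num.min 1 (hdist (x, y) / K).
  apply: le_trans (plateau_dist _ _) _; rewrite le_min ge_min lexx/=.
  rewrite ge_min; apply/orP; right; apply: le_trans (max_dist _ _ _ _) _.
  rewrite ge_max -!mulrBl; apply/andP; split.
    rewrite normrM [X in _ * X]gtr0_norm ?invr_gt0// ler_wpM2r ?invr_ge0//.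
    by rewrite /hdist le_max; apply/orP; left; exact: ler_dist_dist.
  rewrite normrM [X in _ * X]gtr0_norm ?invr_gt0//.
  apply: (@le_trans _ _ (`|hproj x - hproj y| * L^-1)).
    by rewrite ler_wpM2r ?invr_ge0 ?(ltW L0)//; exact: ler_dist_dist.
  apply: (@le_trans _ _ (`|hproj x - hproj y| / `|xlast x| / K)).
    rewrite -mulrA ler_wpM2l// -invfM lef_pV2 ?posrE ?mulr_gt0 ?normr_gt0 ?gt_eqF ?expR_gt0//.
    by rewrite mulrC ler_pM2l// gtr0_norm.
  by rewrite ler_wpM2r ?invr_ge0// /hdist le_max lexx orbT.
move: d; rewrite !le_min => /andP[d1 d2].
rewrite exprn_ile1//= lerXn2r ?nnegrE// divr_ge0//.
Qed.

(** A pair contributes only if one of its points lies in the support, hence in the larger box.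
    Taking that point as the base of [prox] bounds the density by G or by its swap, which accounts
    for the two equal terms. *)
Lemma ground_energy_test_fun :
  (ground_energy alpha (@test_fun R n alpha k) <=
   ((4 * L) ^+ n * (4 * K))%:E *
     \int[mu]_(z in H) (w z * (prox k (e, z) * ker e z))%:E +
   ((4 * L) ^+ n * (4 * K))%:E *
     \int[mu]_(z in H) (w z * (prox k (e, z) * ker e z))%:E)%E.
Proof.
pose g := box_weight (2 * K) (2 * L).
pose G (p : V * V) := `|g p.1| ^+ 2 * (w p.2 / w p.1) * (prox k p * ker p.1 p.2).
have mg : measurable_fun setT g by exact: measurable_box_weight.
have mw := @measurable_hardy_weight R n alpha.
have mf : measurable_fun setT (@test_fun R n alpha k).
  by apply: continuous_measurable_rV; exact: continuous_test_fun.
have mG : measurable_fun setT G.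
  apply: measurable_funM.
    apply: measurable_funM.
      by apply: measurable_funX; apply: measurableT_comp => //; exact: measurable_comp_fst.
    apply: measurable_funM; first exact: measurable_comp_snd.
    apply: measurable_inv_ge0; last by move=> p; exact: hardy_weight_ge0.
    exact: measurable_comp_fst.
  by apply: measurable_funM; [exact: measurable_prox|exact: measurable_riesz_kernel].
have G0 p : 0 <= G p.
  have q0 : 0 <= prox k p * ker p.1 p.2 by rewrite mulr_ge0 ?prox_ge0 ?riesz_kernel_ge0.
  by rewrite mulr_ge0// mulr_ge0 ?exprn_ge0 ?divr_ge0 ?hardy_weight_ge0.
have mGs : measurable_fun setT (fun p => G p + G (p.2, p.1)).
  apply: measurable_funD; first exact: mG.
  by apply: (measurableT_comp mG); exact: measurable_fun_pair.
have GE : (\int[mu \x mu]_(p in H `*` H) (G p)%:E = ((4 * L) ^+ n * (4 * K))%:E *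
     \int[mu]_(z in H) (w z * (prox k (e, z) * ker e z))%:E)%E.
  rewrite (integral_scale_invariant_weight alpha mg (measurable_prox k) (prox_ge0 k)
    (@scale_invariant_prox R n k)).
  congr (_ * _)%E; rewrite hardy_integral_box_weight ?mulr_gt0 ?mulr_ge0 ?expR_ge0//.
  by congr ((_ ^+ _ * _)%:E); ring.
rewrite -GE -integral_halfspaceX_symD//.
apply: ge0_le_integral => //.
- by move=> p _; rewrite lee_fin ground_density_ge0.
- apply: measurable_funTS; apply/measurable_EFinP; exact: measurable_ground_density.
- by apply: measurable_funTS; apply/measurable_EFinP.
move=> [x y] [/= x0 y0]; rewrite lee_fin.
have [wx0 wy0] := (hardy_weight_gt0 alpha x0, hardy_weight_gt0 alpha y0).
have fE z : H z -> test_fun alpha k z / w z = cutoff k z.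
  by move=> z0; rewrite test_funE// mulrC mulKf// gt_eqF// hardy_weight_gt0.
have Gpos x' y' : H x' -> H y' -> cutoff k x' != 0 ->
    w x' * w y' * `|cutoff k x' - cutoff k y'| ^+ 2 * ker x' y' <= G (x', y').
  move=> x'0 y'0 cx'; have wx'0 := hardy_weight_gt0 alpha x'0.
  have xB : hbox (2 * K) (2 * L) x'.
    apply: (@test_fun_support _ _ alpha); rewrite test_funE// mulf_neq0// gt_eqF//.
  have /andP[_ xK] := hbox_xlast xB.
  rewrite /G /g /box_weight/= indicE mem_set// mulr1 (ger0_norm (ltW wx'0)).
  have -> : w x' ^+ 2 * (w y' / w x') = w x' * w y' by field; rewrite gt_eqF.
  rewrite -mulrA ler_wpM2l ?mulr_ge0 ?hardy_weight_ge0//.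
  by rewrite ler_wpM2r ?riesz_kernel_ge0// cutoff_dist.
rewrite /ground_density/= !fE//.
have [cx|cx] := eqVneq (cutoff k x) 0; last first.
  by apply: le_trans (Gpos _ _ x0 y0 cx) _; rewrite lerDl.
have [cy|cy] := eqVneq (cutoff k y) 0; last first.
  rewrite distrC (riesz_kernelC _ x y) [w x * w y]mulrC.
  by apply: le_trans (Gpos _ _ y0 x0 cy) _; rewrite lerDr.
by rewrite cx cy subrr normr0 expr2 !mulr0 mul0r addr_ge0.
Qed.

Lemma hardy_integral_test_fun_ge :
  (((2 * L) ^+ n * (2 * K))%:E <= hardy_integral alpha (@test_fun R n alpha k))%E.
Proof.
rewrite -hardy_integral_box_weight ?(ltW L0)//.
have mf : measurable_fun setT (@test_fun R n alpha k).
  by apply: continuous_measurable_rV; exact: continuous_test_fun.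
apply: ge0_le_integral => //.
- by move=> x _; rewrite lee_fin hardy_integrand_ge0.
- apply: measurable_funTS; apply/measurable_EFinP; apply: measurable_hardy_integrand.
  exact: measurable_box_weight.
- by apply: measurable_funTS; apply/measurable_EFinP; exact: measurable_hardy_integrand.
move=> x x0; rewrite lee_fin ler_wpM2r ?invr_ge0 ?powR_ge0//.
rewrite lerXn2r ?nnegrE// /box_weight indicE.
case: (boolP (x \in _)) => [/set_mem xB|_]; last by rewrite mulr0 normr0.
by rewrite test_funE// cutoff_eq1.
Qed.

End test_function.

Lemma hardy_almost_extremal (d : R) : 0 < d -> exists f : V -> R,
  [/\ Cc_halfspace f, (0 < hardy_integral alpha f)%E &
      (ground_energy alpha f <= d%:E * hardy_integral alpha f)%E].
Proof.
move=> d0.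
pose B k := (\int[mu]_(z in H) (w z * (prox k (e, z) * ker e z))%:E)%E.
have B0 k : (0 <= B k)%E.
  apply: integral_ge0 => z _.
  by rewrite lee_fin !mulr_ge0 ?hardy_weight_ge0 ?prox_ge0 ?riesz_kernel_ge0.
(* The larger box has 2^(n+1) times the Hardy integral of the smaller one, and two equal terms
   occur; this ratio does not depend on k. *)
have d'0 : 0 < d / (2 * 2 ^+ n.+1) by rewrite divr_gt0// mulr_gt0// exprn_gt0.
have [k Bk] : exists k, (B k < (d / (2 * 2 ^+ n.+1))%:E)%E.
  have := integral_prox_cvg0 n alpha_gt1 alpha_lt2.
  move=> /(_ [set x | (x < (d / (2 * 2 ^+ n.+1))%:E)%E]) [].
    exists (d / (2 * 2 ^+ n.+1)) => //= y.
    by rewrite /ball /= sub0r normrN lte_fin => /ltr_normlW.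
  by move=> k _ /(_ k (leqnn k)) h; exists k.
exists (@test_fun R n alpha k).
have L0 : 0 < k.+1%:R * expR (2 * k.+1%:R) :> R by rewrite mulr_gt0// expR_gt0.
split.
- exact: Cc_test_fun.
- apply: lt_le_trans (hardy_integral_test_fun_ge k).
  by rewrite lte_fin mulr_gt0 ?exprn_gt0 ?mulr_gt0.
apply: (le_trans (ground_energy_test_fun k)).
apply: (@le_trans _ _
    (d%:E * ((2 * (k.+1%:R * expR (2 * k.+1%:R))) ^+ n * (2 * k.+1%:R))%:E)%E); last first.
  by rewrite lee_wpmul2l ?lee_fin ?(ltW d0)//; exact: hardy_integral_test_fun_ge.
move: Bk (B0 k); rewrite -/(B k); case: (B k) => [b| |]//.
rewrite lte_fin lee_fin => bd b0.
move: (k.+1%:R * _) L0 => l l0.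
rewrite -EFinM -EFinD -EFinM lee_fin.
have -> : (4 * l) ^+ n = 2 ^+ n * (2 * l) ^+ n by rewrite -exprMn; congr (_ ^+ _); ring.
have P0 : 0 < (2 * l) ^+ n * (2 * k.+1%:R) by rewrite mulr_gt0 ?exprn_gt0 ?mulr_gt0.
have -> : 2 ^+ n * (2 * l) ^+ n * (4 * k.+1%:R) * b + 2 ^+ n * (2 * l) ^+ n * (4 * k.+1%:R) * b
  = (b * (2 * 2 ^+ n.+1)) * ((2 * l) ^+ n * (2 * k.+1%:R)) by rewrite exprS; ring.
rewrite ler_pM2r// -ler_pdivlMr ?mulr_gt0 ?exprn_gt0//; exact: ltW.
Qed.

End sharpness_estimate.

(** * Conclusion *)

Section conclusion.
Variables (R : realType) (n : nat) (alpha : R).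
Hypotheses (alpha_gt1 : 1 < alpha) (alpha_lt2 : alpha < 2).
Local Notation V := 'rV[R]_n.+1.
Local Notation mu := (lebesgue_rV R n.+1).
Local Notation H := (@halfspace R n.+1).

Let mH : measurable H := @measurable_halfspace R n.
Let mHH : measurable (H `*` H) := measurableX mH mH.

Definition hardy_set : set R := [set D : R | forall f : V -> R, Cc_halfspace f ->
  (D%:E * hardy_integral alpha f <= fractional_energy alpha f)%E].

Lemma hardy_integral_ge0 (f : V -> R) : (0 <= hardy_integral alpha f)%E.
Proof. by apply: integral_ge0 => x _; rewrite lee_fin hardy_integrand_ge0. Qed.

Lemma hardy_integral_fin (f : V -> R) : Cc_halfspace f ->
  hardy_integral alpha f \is a fin_num.
Proof.
move=> ccf; rewrite ge0_fin_numE ?hardy_integral_ge0// Cc_hardy_integral_lty//.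
exact: lt_trans alpha_gt1.
Qed.

Lemma trunc_le (F : V * V -> R) m : measurable_fun setT F -> (forall p, 0 <= F p) ->
  (\int[mu \x mu]_(p in H `*` H) (F p * trunc m p)%:E <=
   \int[mu \x mu]_(p in H `*` H) (F p)%:E)%E.
Proof.
move=> mF F0; apply: ge0_le_integral => //.
- by move=> p _; rewrite lee_fin mulr_ge0// trunc_ge0.
- apply: measurable_funTS; apply/measurable_EFinP.
  by apply: measurable_funM; [exact: mF|exact: measurable_trunc].
- by apply: measurable_funTS; apply/measurable_EFinP.
- by move=> p _; rewrite lee_fin ler_piMr// trunc_le1.
Qed.

Lemma energy_density_diag (f : V -> R) x : energy_density alpha f (x, x) = 0.
Proof. by rewrite /energy_density/= subrr normr0 expr2 !mul0r. Qed.

Lemma ground_density_diag (f : V -> R) x : ground_density alpha f (x, x) = 0.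
Proof. by rewrite /ground_density/= subrr normr0 expr2 mul0r mulr0 mul0r. Qed.

(** For an almost extremal f with Hardy integral h, E_m tends to E >= D h while J_m <= J <= (d/2) h.
    Then V_m h = E_m - J_m exceeds (D - d) h for large m, the other half of d paying for E - E_m. *)
Lemma trunc_potential_ge (D d : R) : hardy_set D -> 0 < d ->
  \forall m \near \oo, D - d <= @trunc_potential R n alpha m.
Proof.
move=> DS d0; have d20 : 0 < d / 2 by rewrite divr_gt0.
have [f [ccf h0 Jd]] := hardy_almost_extremal n alpha_gt1 alpha_lt2 d20.
have mf := Cc_halfspace_measurable ccf.
have hfin := hardy_integral_fin ccf.
have DE := DS f ccf.
have mE := measurable_energy_density alpha mf.
have mJ := measurable_ground_density alpha mf.
have E0 := @energy_density_ge0 R n alpha f.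
have J0 := @ground_density_ge0 R n alpha f.
have cE := cvg_trunc mE E0 (energy_density_diag f).
have id m := trunc_ground_state alpha_gt1 alpha_lt2 m mf hfin.
have Jm m := le_trans (trunc_le m mJ J0) Jd.
move: h0 id Jm DE; rewrite -(fineK hfin); move: (fine _) => h.
rewrite lte_fin => h0 id Jm DE.
have lt_E : (((D - d / 2) * h)%:E < fractional_energy alpha f)%E.
  by apply: lt_le_trans DE; rewrite -EFinM lte_fin ltr_pM2r//; lra.
have near_E : \forall m \near \oo, (((D - d / 2) * h)%:E <
    \int[mu \x mu]_(p in H `*` H) (energy_density alpha f p * trunc m p)%:E)%E.
  apply: (cE [set x | (((D - d / 2) * h)%:E < x)%E]).
  exact: (open_ereal_gt' lt_E).
near=> m; have : (((D - d / 2) * h)%:E <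
    \int[mu \x mu]_(p in H `*` H) (energy_density alpha f p * trunc m p)%:E)%E.
  by near: m.
rewrite id => lt_m.
have : (((D - d / 2) * h)%:E < (d / 2 * h)%:E + (trunc_potential n alpha m * h)%:E)%E.
  apply: (lt_le_trans lt_m); rewrite EFinM; apply: leeD2r; rewrite EFinM; exact: Jm.
rewrite -EFinD lte_fin -mulrDl ltr_pM2r//; lra.
Unshelve. all: by end_near. Qed.

(** If [hardy_set] has no supremum, [sup] takes its default value 0, and 0 is itself admissible. *)
Lemma hardy_constant_adherent (d : R) : 0 < d ->
  exists2 D, hardy_set D & hardy_constant n.+1 alpha - d < D.
Proof.
move=> d0; have [hs|hs] := pselect (has_sup hardy_set).
  have [D DS Dlt] := sup_adherent d0 hs; by exists D.
exists 0; first by move=> f _; rewrite mul0e; apply: integral_ge0 => p _;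
  rewrite lee_fin; exact: (@energy_density_ge0 R n alpha f p).
by rewrite /hardy_constant sup_out//; lra.
Qed.

(** The potential V_m comes arbitrarily close to the sharp constant from below or exceeds it, so J_m
    <= E - (C - 2d) h for large m; first m tends to infinity, then the error to 0. *)
Lemma ground_energy_le (f : V -> R) : Cc_halfspace f ->
  (ground_energy alpha f <=
   fractional_energy alpha f - (hardy_constant n.+1 alpha)%:E * hardy_integral alpha f)%E.
Proof.
have alg (E J : \bar R) (v c eps : R) : c - eps <= v -> (J + v%:E <= E)%E ->
    (J <= E - c%:E + eps%:E)%E.
  move=> cv; case: J => [j| |]; case: E => [E| |]//=; rewrite ?leey ?leNye//.
  by rewrite !lee_fin; lra.
move=> ccf; have mf := Cc_halfspace_measurable ccf.
have hfin := hardy_integral_fin ccf.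
have mE := measurable_energy_density alpha mf.
have mJ := measurable_ground_density alpha mf.
have E0 := @energy_density_ge0 R n alpha f.
have J0 := @ground_density_ge0 R n alpha f.
have cJ := cvg_trunc mJ J0 (ground_density_diag f).
have id m := trunc_ground_state alpha_gt1 alpha_lt2 m mf hfin.
have Em m : (_ <= fractional_energy alpha f)%E := trunc_le m mE E0.
have h0 := hardy_integral_ge0 f.
move: h0 id; rewrite -(fineK hfin); move: (fine _) => h; rewrite lee_fin => h0 id.
set C := hardy_constant _ _.
apply/lee_addgt0Pr => eps eps0.
(* One d approximates the sharp constant by an admissible D, the other bounds V_m; h + 1 avoids
   division by 0. *)
pose d := eps / (h + 1) / 2.
have h1 : 0 < h + 1 by rewrite ltr_wpDl.
have d0 : 0 < d by rewrite !divr_gt0.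
have dh : (d + d) * h <= eps.
  have -> : d + d = eps / (h + 1) by rewrite /d; lra.
  by rewrite mulrAC ler_pdivrMr// ler_pM2l//; lra.
have [D DS] := hardy_constant_adherent d0; rewrite -/C => DC.
have near_J : \forall m \near \oo, (\int[mu \x mu]_(p in H `*` H)
    (ground_density alpha f p * trunc m p)%:E <=
    fractional_energy alpha f - C%:E * h%:E + eps%:E)%E.
  near=> m.
  have Vm : D - d <= trunc_potential n alpha m by near: m; exact: trunc_potential_ge.
  have Vh : C * h - eps <= trunc_potential n alpha m * h.
    have : (C - d - d) * h <= trunc_potential n alpha m * h by rewrite ler_wpM2r//; lra.
    by move: dh; rewrite !mulrDl !mulNr; lra.
  by have := Em m; rewrite id -!EFinM; exact: alg.
apply: (@closed_cvg _ _ _ _ _ (fun x => x <= _)%E _ near_J _ cJ).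
exact: closed_ereal_ge_ereal.
Unshelve. all: by end_near. Qed.

End conclusion.

Theorem theorem1p2 (R : realType) (n : nat) (alpha : R)
    (n_ge2 : (2 <= n)%N) (alpha_gt1 : 1 < alpha) (alpha_lt2 : alpha < 2) :
  let p : R := 2 * n%:R / (n%:R - alpha) in
  exists2 a : R, 0 < a &
    forall f : 'rV[R]_n -> R, Cc_infty_halfspace f ->
      (fractional_energy alpha f -
         (hardy_constant n alpha)%:E * hardy_integral alpha f >=
       a%:E * (\int[lebesgue_rV R n]_(x in @halfspace R n)
                 (`|f x| `^ p)%:E) `^ (2 / p))%E.
Proof.
(* [2 <= n.+1] is by conversion [0 < n], the form used by [ground_sobolev]. *)
case: n n_ge2 => [//|n n_gt0] p.
have [a a0 sobolev] := ground_sobolev alpha_gt1 alpha_lt2 n_gt0.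
exists a => // f [ccf _].
have N2 : 2 <= n.+1%:R :> R by rewrite ler_nat.
have p0 : 0 < p by rewrite divr_gt0// ?mulr_gt0//; lra.
apply: le_trans (ground_energy_le alpha_gt1 alpha_lt2 ccf).
apply: sobolev; first exact: Cc_halfspace_measurable.
exact: Cc_integral_powR_lty.
Qed.
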